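(* Let $\mathbf{u}$ be an axially symmetric smooth solution with no swirl of the steady Navier-Stokes equations $(\mathbf{u}\cdot\nabla)\mathbf{u}+\nabla p=\Delta\mathbf{u}$, $\operatorname{div}\mathbf{u}=0$ in $\mathbb{R}^3$ such that $\lim_{|\mathbf{x}|\to\infty}\mathbf{u}(\mathbf{x})=0$. Then $\mathbf{u}\equiv 0$.
   Context: Cylindrical coordinates: $r=\sqrt{x_1^2+x_2^2}$, $\theta=\arctan(x_2/x_1)$, $z=x_3$, with $\mathbf{e}_r=(\cos\theta,\sin\theta,0)$, $\mathbf{e}_\theta=(-\sin\theta,\cos\theta,0)$, $\mathbf{e}_z=(0,0,1)$. A vector field $\mathbf{u}=u_r\mathbf{e}_r+u_\theta\mathbf{e}_\theta+u_z\mathbf{e}_z$ is axially symmetric if $u_r,u_\theta,u_z$ do not depend on $\theta$; it is axially symmetric with no swirl if moreover $u_\theta\equiv 0$. The scalar function $p$ is the associated pressure. *)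

(* Defs.v *)
From HB Require Import structures.
From mathcomp Require Import all_boot all_order all_algebra.
From mathcomp Require Import all_classical all_reals all_analysis.

Set Implicit Arguments.
Unset Strict Implicit.
Unset Printing Implicit Defensive.

Import Order.TTheory GRing.Theory Num.Theory.
Import numFieldNormedType.Exports.

Local Open Scope classical_set_scope.
Local Open Scope ring_scope.

Section Calculus.
Context {R : realType} {n : nat}.

Definition basis_vec (i : 'I_n) : 'rV[R]_n := delta_mx 0 i.

Definition dot (v w : 'rV[R]_n) : R := \sum_(i < n) v 0 i * w 0 i.

(* The library norm on row vectors is the sup norm; this is the Euclidean one. *)
Definition enorm (x : 'rV[R]_n) : R := Num.sqrt (dot x x).

(* The filter of neighbourhoods of infinity: f @ at_infinity --> l means
   f x --> l as |x| --> +oo. *)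
Definition at_infinity : set_system 'rV[R]_n :=
  [set A | exists M : R, forall x, M < enorm x -> A x].

Global Instance at_infinity_filter : Filter at_infinity.
Proof.
split; first by exists 0.
- move=> A B [M MA] [N NB]; exists (Num.max M N) => x.
  by rewrite gt_max => /andP[Mx Nx]; split; [exact: MA|exact: NB].
- by move=> A B AB [M MA]; exists M => x /MA /AB.
Qed.

Definition partial (V : normedModType R) (i : 'I_n) (f : 'rV[R]_n -> V) :
  'rV[R]_n -> V := 'D_(basis_vec i) f.

Fixpoint Ck (V : normedModType R) (k : nat) (f : 'rV[R]_n -> V) : Prop :=
  if k is k'.+1 then
    (forall x, differentiable f x) /\ (forall i, Ck k' (partial i f))
  else continuous f.

Definition smooth (V : normedModType R) (f : 'rV[R]_n -> V) : Prop :=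
  forall k, Ck k f.

Definition grad (p : 'rV[R]_n -> R) (x : 'rV[R]_n) : 'rV[R]_n :=
  \row_i partial i p x.

Definition div (u : 'rV[R]_n -> 'rV[R]_n) (x : 'rV[R]_n) : R :=
  \sum_(i < n) partial i (fun y => u y 0 i) x.

Definition laplacian (V : normedModType R) (f : 'rV[R]_n -> V)
    (x : 'rV[R]_n) : V :=
  \sum_(i < n) partial i (partial i f) x.

(* (u . nabla) v *)
Definition convect (V : normedModType R) (u : 'rV[R]_n -> 'rV[R]_n)
    (v : 'rV[R]_n -> V) (x : 'rV[R]_n) : V :=
  \sum_(i < n) u x 0 i *: partial i v x.

Definition steady_navier_stokes (u : 'rV[R]_n -> 'rV[R]_n)
    (p : 'rV[R]_n -> R) : Prop :=
  (forall x, convect u u x + grad p x = laplacian u x) /\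
  (forall x, div u x = 0).

End Calculus.

Section Cylindrical.
Context {R : realType}.

Definition vec3 (a b c : R) : 'rV[R]_3 := \row_i nth 0 [:: a; b; c] i.

Definition e_r (theta : R) : 'rV[R]_3 := vec3 (cos theta) (sin theta) 0.
Definition e_theta (theta : R) : 'rV[R]_3 := vec3 (- sin theta) (cos theta) 0.
Definition e_z : 'rV[R]_3 := vec3 0 0 1.

Definition cyl_point (r theta z : R) : 'rV[R]_3 := r *: e_r theta + z *: e_z.

(* Since (e_r, e_theta, e_z) is orthonormal, the components of u in this frame
   are inner products.  They are meaningful off the axis, that is for 0 < r,
   with theta ranging over all of R. *)
Definition comp_r (u : 'rV[R]_3 -> 'rV[R]_3) (r theta z : R) : R :=
  dot (u (cyl_point r theta z)) (e_r theta).
Definition comp_theta (u : 'rV[R]_3 -> 'rV[R]_3) (r theta z : R) : R :=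
  dot (u (cyl_point r theta z)) (e_theta theta).
Definition comp_z (u : 'rV[R]_3 -> 'rV[R]_3) (r theta z : R) : R :=
  dot (u (cyl_point r theta z)) e_z.

Definition theta_independent (f : R -> R -> R -> R) : Prop :=
  forall r theta1 theta2 z, 0 < r -> f r theta1 z = f r theta2 z.

Definition axially_symmetric (u : 'rV[R]_3 -> 'rV[R]_3) : Prop :=
  [/\ theta_independent (comp_r u), theta_independent (comp_theta u)
    & theta_independent (comp_z u)].

Definition no_swirl (u : 'rV[R]_3 -> 'rV[R]_3) : Prop :=
  forall r theta z, 0 < r -> comp_theta u r theta z = 0.

End Cylindrical.

(* Main.v *)
(** Write [U], [W] for the radial and axial velocities and [w = U_z - W_r] for the
    vorticity on the half plane [0 < r].  Without swirl, [Omega = w / r] satisfies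
    [lap5 Omega = 0], where [lap5] is the axisymmetric Laplacian of R^5 with the
    drift [- u . grad]; there is no term of order zero, so the maximum principle
    applies.  The point is that [Omega] tends to 0 at infinity although only [u] is
    known to decay.  Bernstein's method replaces elliptic regularity: at a maximum of
    [a^2 eta^4 w^2 / 2 + 368 eta^2 (U^2 + W^2)], with [eta] a cutoff of the square of
    half-side [a <= 1, r / 2], the dissipation [|grad u|^2 >= w^2 / 2] absorbs the
    cutoff errors, whence [a |w| <= 900 sup |u|].  Near the axis this only gives
    [|Omega| <= C sup |u| / r^2], which is improved to [|Omega| <= C sup |u|] by
    comparison on a unit cylinder with the superharmonic functions [1 / |x - p|^2],
    the poles [p] being the centres of its two ends.  The axis is removable thanks to
    the barrier [r^-2 + k / r].  Then [Omega] vanishes by comparison with constants.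
    Finally [U / r] is harmonic in R^5, and comparison with [e / r] gives [U = 0],
    so [W_r = 0] and [W = 0]. *)
Require Import Defs.
From mathcomp Require Import all_boot all_order all_algebra.
From mathcomp Require Import all_classical all_reals all_analysis.
From mathcomp Require Import ring lra.

Set Implicit Arguments.
Unset Strict Implicit.
Unset Printing Implicit Defensive.

Import Order.TTheory GRing.Theory Num.Theory.
Import numFieldNormedType.Exports.

Local Open Scope classical_set_scope.
Local Open Scope ring_scope.

(** * Real derivatives *)

Section RealDerivatives.
Context {R : realType}.
Implicit Types (f g : R -> R) (x a b c d : R).

Lemma derivative_add f g x a b : is_derive x 1 f a -> is_derive x 1 g b ->
  is_derive x 1 (fun y => f y + g y) (a + b).
Proof. by move=> df dg; exact: (is_deriveD df dg). Qed.

Lemma derivative_opp f x a : is_derive x 1 f a ->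
  is_derive x 1 (fun y => - f y) (- a).
Proof. by move=> df; exact: (is_deriveN df). Qed.

Lemma derivative_mul f g x a b : is_derive x 1 f a -> is_derive x 1 g b ->
  is_derive x 1 (fun y => f y * g y) (a * g x + f x * b).
Proof.
move=> df dg; have -> : a * g x + f x * b = f x *: b + g x *: a.
  by rewrite /GRing.scale /= addrC [a * _]mulrC.
exact: (is_deriveM df dg).
Qed.

Lemma derivative_inv f x a : f x != 0 -> is_derive x 1 f a ->
  is_derive x 1 (fun y => (f y)^-1) (- a / f x ^+ 2).
Proof.
move=> fx0 [df <-]; apply: DeriveDef; first exact: derivableV.
by rewrite deriveV // /GRing.scale /= !mulNr mulrC.
Qed.

Lemma derivative_exp f n x a : is_derive x 1 f a ->
  is_derive x 1 (fun y => f y ^+ n) (n%:R * f x ^+ n.-1 * a).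
Proof.
move=> df; have -> : (fun y => f y ^+ n) = f ^+ n.
  by apply/funext => y; rewrite exprfctE.
exact: (is_deriveX n df).
Qed.

Lemma derivative_unique f x a b :
  is_derive x 1 f a -> is_derive x 1 f b -> a = b.
Proof. by move=> [_ <-] [_ <-]. Qed.

Lemma derivative_continuous f x a : is_derive x 1 f a -> {for x, continuous f}.
Proof.
by move=> [df _]; apply/differentiable_continuous/derivable1_diffP.
Qed.

Lemma mean_value f df a b : a < b ->
  (forall x, a <= x <= b -> is_derive x 1 f (df x)) ->
  exists2 c, a < c < b & f b - f a = df c * (b - a).
Proof.
move=> ab dfP; have [||c] := @MVT R f df a b ab.
- by move=> x; rewrite in_itv /= => /andP[ax xb]; apply: dfP; rewrite !ltW.
- apply: derivable_within_continuous => x.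
  by rewrite in_itv /= => /dfP[].
- by rewrite in_itv /= => abc ->; exists c.
Qed.

(** The second derivative is assumed only at [c], so there is no Taylor expansion to use. If [d]
    were positive, [df] would be positive just to the right of [c], and the mean value theorem would
    give a value of [f] above [f c]. *)
Lemma local_max_derivative f df d a b c : a < c < b ->
  (forall x, a < x < b -> is_derive x 1 f (df x)) ->
  (forall x, a < x < b -> f x <= f c) -> is_derive c 1 df d ->
  df c = 0 /\ d <= 0.
Proof.
move=> /andP[ac cb] fP fmax dfc.
have dfc0 : df c = 0.
  have abc : a < c < b by rewrite ac.
  apply: (derivative_unique (fP c abc)).
  apply: (@derive1_at_max _ f a b c).
  - by rewrite ltW ?(lt_trans ac).
  - by move=> t; rewrite in_itv /= => /fP[].
  - by rewrite in_itv.
  - by move=> t; rewrite in_itv /=; exact: fmax.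
split=> //; rewrite leNgt; apply/negP => d0.
(* A positive second derivative makes f increase just to the right of c. *)
have : h^-1 *: (df (h *: 1 + c) - df c) @[h --> 0^'+] --> d.
  case: dfc => dd <-; apply: cvg_trans dd.
  apply: cvg_app => A /= [e e0 eA]; exists e => // y ye y0.
  by apply: eA => //=; rewrite gt_eqF.
move=> /cvgrPdist_lt /(_ d d0) cv.
have [e /= e0 eP] : exists2 e, 0 < e & forall h, 0 < h < e -> 0 < df (h + c).
  case: cv => e /= e0 eA; exists e => // h /andP[h0' he].
  have := eA h; rewrite /= sub0r normrN gtr0_norm // => /(_ he h0').
  rewrite dfc0 subr0 /GRing.scale /= mulr1 => H.
  have : 0 < h^-1 * df (h + c).
    by move: H; rewrite ltr_norml => /andP[_]; lra.
  by rewrite pmulr_rgt0 // invr_gt0.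
pose h := Num.min (e / 2) ((b - c) / 2).
have h0 : 0 < h by rewrite lt_min; apply/andP; split; lra.
have he : h < e by rewrite gt_min; apply/orP; left; lra.
have hb : c + h < b.
  have : h <= (b - c) / 2 by rewrite ge_min lexx orbT.
  lra.
clearbody h.
have cch : c < c + h by rewrite ltrDl.
have dfh x : c <= x <= c + h -> is_derive x 1 f (df x).
  by move=> xh; apply: fP; lra.
have [x /andP[cx xh] E] := mean_value cch dfh.
have : 0 < df x.
  have -> : x = (x - c) + c by lra.
  by apply: eP; lra.
move=> dx; have := fmax (c + h); rewrite hb (lt_trans ac) ?ltrDl//= => /(_ isT).
have : 0 < df x * (c + h - c) by apply: mulr_gt0 => //; lra.
lra.
Qed.

End RealDerivatives.

(** * Symmetry of mixed second derivatives *)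

Section Schwarz.
Context {R : realType}.

(** The second difference of [f] over the square with corner [(a, b)] and side [e] does not depend
    on the order in which the differences are taken. Two uses of the mean value theorem in each
    order write it as [e ^+ 2] times a value of [f12] and as [e ^+ 2] times a value of [f21] in the
    square. By continuity at [(a, b)] the midpoint [m] separates these values for small [e]. *)
Let schwarz_lt (f f1 f2 f12 f21 : R -> R -> R) (a b : R) :
  (forall x y : R, is_derive x 1 (f ^~ y) (f1 x y)) ->
  (forall x y : R, is_derive y 1 (f x) (f2 x y)) ->
  (forall x y : R, is_derive y 1 (f1 x) (f12 x y)) ->
  (forall x y : R, is_derive x 1 (f2 ^~ y) (f21 x y)) ->
  {for (a, b), continuous (fun p : R * R => f12 p.1 p.2)} ->
  {for (a, b), continuous (fun p : R * R => f21 p.1 p.2)} ->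
  ~ f12 a b < f21 a b.
Proof.
move=> d1 d2 d12 d21 c12 c21 lt.
pose m := (f12 a b + f21 a b) / 2.
have [e e0 eP] : exists2 e, 0 < e & forall x y, a <= x <= a + e -> b <= y <= b + e ->
    f12 x y < m < f21 x y.
  have A : \forall p \near (a, b), f12 p.1 p.2 < m.
    by move/cvgr_lt: c12 => /(_ m); apply; rewrite /m /=; lra.
  have B : \forall p \near (a, b), m < f21 p.1 p.2.
    by move/cvgr_gt: c21 => /(_ m); apply; rewrite /m /=; lra.
  have [e /= e0 eAB] := (nbhs_ballP _ _).1 (filterI A B).
  exists (e / 2); first lra.
  move=> x y hx hy; have [|/= -> ->] // := eAB (x, y).
  by split => /=; rewrite /ball /= distrC ger0_norm; lra.
have ab : a < a + e by lra.
have bb : b < b + e by lra.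
have [x hx Ex] := @mean_value R (fun x => f x (b + e) - f x b)
  (fun x => f1 x (b + e) - f1 x b) _ _ ab
  (fun x _ => derivative_add (d1 x (b + e)) (derivative_opp (d1 x b))).
have [y hy Ey] := @mean_value R (f1 x) (f12 x) _ _ bb (fun y _ => d12 x y).
have [y' hy' Ey'] := @mean_value R (fun y => f (a + e) y - f a y)
  (fun y => f2 (a + e) y - f2 a y) _ _ bb
  (fun y _ => derivative_add (d2 (a + e) y) (derivative_opp (d2 a y))).
have [x' hx' Ex'] := @mean_value R (f2 ^~ y') (f21 ^~ y') _ _ ab (fun x _ => d21 x y').
have /andP[H _] : f12 x y < m < f21 x y by apply: eP; lra.
have /andP[_ H'] : f12 x' y' < m < f21 x' y' by apply: eP; lra.
have E : f12 x y * e * e = f21 x' y' * e * e.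
  have -> : f12 x y * e = f1 x (b + e) - f1 x b by rewrite Ey; ring.
  have -> : f21 x' y' * e = f2 (a + e) y' - f2 a y' by rewrite Ex'; ring.
  have ea : a + e - a = e by ring.
  have eb : b + e - b = e by ring.
  by move: Ex Ey'; rewrite ea eb => <- <-; ring.
have en : e != 0 by rewrite gt_eqF.
by move: (mulIf en (mulIf en E)); lra.
Qed.

Lemma schwarz (f f1 f2 f12 f21 : R -> R -> R) (a b : R) :
  (forall x y : R, is_derive x 1 (f ^~ y) (f1 x y)) ->
  (forall x y : R, is_derive y 1 (f x) (f2 x y)) ->
  (forall x y : R, is_derive y 1 (f1 x) (f12 x y)) ->
  (forall x y : R, is_derive x 1 (f2 ^~ y) (f21 x y)) ->
  {for (a, b), continuous (fun p : R * R => f12 p.1 p.2)} ->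
  {for (a, b), continuous (fun p : R * R => f21 p.1 p.2)} ->
  f12 a b = f21 a b.
Proof.
move=> d1 d2 d12 d21 c12 c21.
have swap_continuous g : {for (a, b), continuous (fun p : R * R => g p.1 p.2)} ->
    {for (b, a), continuous (fun p : R * R => g p.2 p.1 : R)}.
  move=> cg; apply: (@continuous_comp _ _ _ (fun p : R * R => (p.2, p.1))
    (fun p => g p.1 p.2)) => //.
  by apply: (cvg_pair (G := nbhs a) (H := nbhs b)); [exact: cvg_snd|exact: cvg_fst].
case: (ltgtP (f12 a b) (f21 a b)) => // lt; exfalso.
  exact: (@schwarz_lt f f1 f2 f12 f21 a b).
by apply: (@schwarz_lt (fun x y => f y x) (fun x y => f2 y x) (fun x y => f1 y x)
  (fun x y => f21 y x) (fun x y => f12 y x) b a) => //; exact: swap_continuous.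
Qed.

End Schwarz.

(** * Maximum principle in the half plane *)

Section Jets.
Context {R : realType}.

(** The mixed second derivative is left out, since neither the operators below nor the conditions at
    a maximum involve it. The derivatives of sums, products and inverses are carried along formally,
    so that differential identities reduce to [ring] or [field]. *)
Record jet := Jet { jv : R -> R -> R; j1 : R -> R -> R; j2 : R -> R -> R;
  j11 : R -> R -> R; j22 : R -> R -> R }.

(** Every clause is restricted to [0 < r], which admits [r^-1] as a jet. Joint continuity does not
    follow from the partial derivatives and is what the extreme value theorem needs. *)
Record jet_ok (J : jet) : Prop := JetOk {
  jet_d1 : forall r z : R, 0 < r -> is_derive r 1 (jv J ^~ z) (j1 J r z);
  jet_d2 : forall r z : R, 0 < r -> is_derive z 1 (jv J r) (j2 J r z);
  jet_d11 : forall r z : R, 0 < r -> is_derive r 1 (j1 J ^~ z) (j11 J r z);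
  jet_d22 : forall r z : R, 0 < r -> is_derive z 1 (j2 J r) (j22 J r z);
  jet_continuous : forall r z : R, 0 < r ->
    {for (r, z), continuous (fun x : R * R => jv J x.1 x.2)} }.

Definition jet_cst (c : R) : jet :=
  Jet (fun _ _ => c) (fun _ _ => 0) (fun _ _ => 0) (fun _ _ => 0) (fun _ _ => 0).

Definition jet_r : jet :=
  Jet (fun r _ => r) (fun _ _ => 1) (fun _ _ => 0) (fun _ _ => 0) (fun _ _ => 0).

Definition jet_z : jet :=
  Jet (fun _ z => z) (fun _ _ => 0) (fun _ _ => 1) (fun _ _ => 0) (fun _ _ => 0).

Definition jet_expz (k : R) : jet :=
  Jet (fun _ z => expR (k * z)) (fun _ _ => 0) (fun _ z => k * expR (k * z))
      (fun _ _ => 0) (fun _ z => k ^+ 2 * expR (k * z)).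

Definition jet_add (F G : jet) : jet :=
  Jet (fun r z => jv F r z + jv G r z) (fun r z => j1 F r z + j1 G r z)
      (fun r z => j2 F r z + j2 G r z) (fun r z => j11 F r z + j11 G r z)
      (fun r z => j22 F r z + j22 G r z).

Definition jet_mul (F G : jet) : jet :=
  Jet (fun r z => jv F r z * jv G r z)
      (fun r z => j1 F r z * jv G r z + jv F r z * j1 G r z)
      (fun r z => j2 F r z * jv G r z + jv F r z * j2 G r z)
      (fun r z => j11 F r z * jv G r z + 2 * (j1 F r z * j1 G r z)
                  + jv F r z * j11 G r z)
      (fun r z => j22 F r z * jv G r z + 2 * (j2 F r z * j2 G r z)
                  + jv F r z * j22 G r z).

Definition jet_inv (F : jet) : jet :=
  Jet (fun r z => (jv F r z)^-1)
      (fun r z => - j1 F r z / jv F r z ^+ 2)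
      (fun r z => - j2 F r z / jv F r z ^+ 2)
      (fun r z => - j11 F r z / jv F r z ^+ 2 + 2 * j1 F r z ^+ 2 / jv F r z ^+ 3)
      (fun r z => - j22 F r z / jv F r z ^+ 2 + 2 * j2 F r z ^+ 2 / jv F r z ^+ 3).

Definition jet_opp (F : jet) : jet := jet_mul (jet_cst (-1)) F.

Lemma jet_cst_ok c : jet_ok (jet_cst c).
Proof.
by split=> r z _ /=; try exact: is_derive_cst; exact: cvg_cst.
Qed.

Lemma jet_r_ok : jet_ok jet_r.
Proof.
by split=> r z _ /=; try exact: is_derive_cst; try exact: is_derive_id;
  exact: cvg_fst.
Qed.

Lemma jet_z_ok : jet_ok jet_z.
Proof.
by split=> r z _ /=; try exact: is_derive_cst; try exact: is_derive_id;
  exact: cvg_snd.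
Qed.

Lemma jet_expz_ok k : jet_ok (jet_expz k).
Proof.
have dexp (z : R) : is_derive z 1 (fun y => expR (k * y)) (k * expR (k * z)).
  have := is_derive1_comp (is_derive_expR (k * z))
    (derivative_mul (is_derive_cst k z 1) (is_derive_id z 1)).
  by rewrite mul0r add0r mulr1 mulrC.
split=> r z _ /=; try exact: is_derive_cst; try exact: dexp.
  apply: (is_derive_eq (derivative_mul (is_derive_cst k z 1) (dexp z))).
  by rewrite /=; ring.
apply: (@continuous_comp _ _ _ (fun x : R * R => x.2) (fun y => expR (k * y))).
  exact: cvg_snd.
exact: derivative_continuous (dexp z).
Qed.

Lemma jet_add_ok F G : jet_ok F -> jet_ok G -> jet_ok (jet_add F G).
Proof.
case=> F1 F2 F11 F22 cF [G1 G2 G11 G22 cG].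
split=> r z r0 /=; try by apply: derivative_add; auto.
by apply: cvgD; [exact: cF|exact: cG].
Qed.

Lemma jet_mul_ok F G : jet_ok F -> jet_ok G -> jet_ok (jet_mul F G).
Proof.
case=> F1 F2 F11 F22 cF [G1 G2 G11 G22 cG].
split=> r z r0 /=; try by apply: derivative_mul; auto.
- apply: (is_derive_eq (derivative_add
    (derivative_mul (F11 r z r0) (G1 r z r0)) (derivative_mul (F1 r z r0) (G11 r z r0)))).
  by rewrite /=; ring.
- apply: (is_derive_eq (derivative_add
    (derivative_mul (F22 r z r0) (G2 r z r0)) (derivative_mul (F2 r z r0) (G22 r z r0)))).
  by rewrite /=; ring.
- by apply: cvgM; [exact: cF|exact: cG].
Qed.

Lemma jet_opp_ok F : jet_ok F -> jet_ok (jet_opp F).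
Proof. by apply: jet_mul_ok; exact: jet_cst_ok. Qed.

Lemma jet_inv_ok F : (forall r z, 0 < r -> jv F r z != 0) ->
  jet_ok F -> jet_ok (jet_inv F).
Proof.
move=> F0 [F1 F2 F11 F22 cF].
split=> r z r0 /=; try by apply: derivative_inv; auto.
- apply: (is_derive_eq (derivative_mul (derivative_opp (F11 r z r0))
    (derivative_inv (f := fun x => jv F x z ^+ 2) (expf_neq0 2 (F0 r z r0)) (derivative_exp 2 (F1 r z r0))))).
  by rewrite /=; field; exact: F0.
- apply: (is_derive_eq (derivative_mul (derivative_opp (F22 r z r0))
    (derivative_inv (f := fun x => jv F r x ^+ 2) (expf_neq0 2 (F0 r z r0)) (derivative_exp 2 (F2 r z r0))))).
  by rewrite /=; field; exact: F0.
- by apply: cvgV; [exact: F0|exact: cF].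
Qed.

(** A positive value would make the maximum over the compact rectangle positive, hence interior.
    There the gradient vanishes and the pure second derivatives are nonpositive, which the last
    hypothesis excludes. Each application has to refute only this configuration. *)
Lemma jet_max (J : jet) (a b c d : R) : jet_ok J -> 0 < a -> a <= b -> c <= d ->
  (forall z, c <= z <= d -> jv J a z <= 0) ->
  (forall z, c <= z <= d -> jv J b z <= 0) ->
  (forall r, a <= r <= b -> jv J r c <= 0) ->
  (forall r, a <= r <= b -> jv J r d <= 0) ->
  (forall r z, a < r < b -> c < z < d -> 0 < jv J r z ->
    j1 J r z = 0 -> j2 J r z = 0 -> j11 J r z <= 0 -> j22 J r z <= 0 -> False) ->
  forall r z, a <= r <= b -> c <= z <= d -> jv J r z <= 0.
Proof.
move=> [J1 J2 J11 J22 cJ] a0 ab cd Ja Jb Jc Jd Jin r0 z0 rab zcd.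
rewrite leNgt; apply/negP => Jpos.
have [|||[r z]] := @compact_EVT_max _ R (fun x : R * R => jv J x.1 x.2)
    (`[a, b] `*` `[c, d]).
- by exists (a, c); split; rewrite /= in_itv /= lexx.
- by apply: compact_setX; exact: segment_compact.
- apply: continuous_in_subspaceT => -[r z]; rewrite inE => -[] /=.
  by rewrite !in_itv /= => /andP[ar _] _; apply: cJ; exact: lt_le_trans ar.
rewrite inE => -[] /=; rewrite !in_itv /= => arb czd Jmax.
have {}Jmax r' z' : a <= r' <= b -> c <= z' <= d -> jv J r' z' <= jv J r z.
  move=> hr hz; have /= := Jmax (r', z'); apply.
  by rewrite inE; split; rewrite /= in_itv.
have Jrz : 0 < jv J r z by apply: lt_le_trans Jpos _; exact: Jmax.
have ra : r != a by apply/eqP => E; move: (Ja z czd); rewrite -E leNgt Jrz.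
have rb : r != b by apply/eqP => E; move: (Jb z czd); rewrite -E leNgt Jrz.
have zc : z != c by apply/eqP => E; move: (Jc r arb); rewrite -E leNgt Jrz.
have zd : z != d by apply/eqP => E; move: (Jd r arb); rewrite -E leNgt Jrz.
have arb' : a < r < b.
  by move: arb; rewrite !le_eqVlt eq_sym (negbTE ra) (negbTE rb).
have czd' : c < z < d.
  by move: czd; rewrite !le_eqVlt eq_sym (negbTE zc) (negbTE zd).
have rgt0 : 0 < r by lra.
have [e1 e2] := @local_max_derivative _ (jv J ^~ z) (j1 J ^~ z) (j11 J r z) a b r
  arb' (fun x hx => J1 x z (lt_trans a0 (andP hx).1))
  (fun x hx => Jmax x z ltac:(lra) czd) (J11 r z rgt0).
have [e3 e4] := @local_max_derivative _ (jv J r) (j2 J r) (j22 J r z) c d z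
  czd' (fun x _ => J2 r x rgt0)
  (fun x hx => Jmax r x arb ltac:(lra)) (J22 r z rgt0).
exact: (Jin r z).
Qed.

End Jets.

(** * Interior vorticity bound *)

(* The weight [368 = 736 / 2] makes the dissipation [736 * e^2 * |grad u|^2], with
   [w^2 <= 2 * |grad u|^2], dominate the cutoff errors [229 * e^2 * w^2]; each bound
   [H1]-[H9] completes a square or uses the size of the cutoff. *)
Lemma bernstein_pointwise (R : realFieldType)
  (a s i e er ez err ezz U Ur Uz Urr Uzz W Wr Wz Wrr Wzz w wr wz wrr wzz : R) :
  a * s = 1 -> 1 <= s -> 0 <= i <= s -> 0 <= e <= 1 ->
  er ^+ 2 + ez ^+ 2 <= 8 * s ^+ 2 ->
  - 10 * s ^+ 2 <= err + ezz + i * er - U * er - W * ez ->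
  -1 <= U <= 1 -> -1 <= W <= 1 ->
  w = Uz - Wr ->
  Urr + i * Ur + Uzz - i ^+ 2 * U = wz ->
  Wrr + i * Wr + Wzz = - (wr + i * w) ->
  wrr + i * wr + wzz - i ^+ 2 * w = U * wr + W * wz - i * U * w ->
  let Pr := a ^+ 2 / 2 * (4 * e ^+ 3 * er * w ^+ 2 + 2 * e ^+ 4 * w * wr)
    + 368 * (2 * e * er * (U ^+ 2 + W ^+ 2) + e ^+ 2 * (2 * U * Ur + 2 * W * Wr)) in
  let Pz := a ^+ 2 / 2 * (4 * e ^+ 3 * ez * w ^+ 2 + 2 * e ^+ 4 * w * wz)
    + 368 * (2 * e * ez * (U ^+ 2 + W ^+ 2) + e ^+ 2 * (2 * U * Uz + 2 * W * Wz)) in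
  let Prr := a ^+ 2 / 2 * ((4 * e ^+ 3 * err + 12 * e ^+ 2 * er ^+ 2) * w ^+ 2
      + 16 * e ^+ 3 * er * w * wr + 2 * e ^+ 4 * (w * wrr + wr ^+ 2))
    + 368 * ((2 * e * err + 2 * er ^+ 2) * (U ^+ 2 + W ^+ 2)
      + 8 * e * er * (U * Ur + W * Wr)
      + 2 * e ^+ 2 * (U * Urr + Ur ^+ 2 + W * Wrr + Wr ^+ 2)) in
  let Pzz := a ^+ 2 / 2 * ((4 * e ^+ 3 * ezz + 12 * e ^+ 2 * ez ^+ 2) * w ^+ 2
      + 16 * e ^+ 3 * ez * w * wz + 2 * e ^+ 4 * (w * wzz + wz ^+ 2))
    + 368 * ((2 * e * ezz + 2 * ez ^+ 2) * (U ^+ 2 + W ^+ 2)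
      + 8 * e * ez * (U * Uz + W * Wz)
      + 2 * e ^+ 2 * (U * Uzz + Uz ^+ 2 + W * Wzz + Wz ^+ 2)) in
  Pr = 0 -> Pz = 0 -> Prr <= 0 -> Pzz <= 0 ->
  e ^+ 2 * w ^+ 2 <= 736 * 1010 * (s ^+ 2 * (U ^+ 2 + W ^+ 2)).
Proof.
move=> as1 s1 /andP[i0 is_] /andP[e0 e1] N8 Le U1 W1 wE.
set L := err + ezz + i * er - U * er - W * ez in Le.
set N := er ^+ 2 + ez ^+ 2 in N8.
pose D := Ur ^+ 2 + Uz ^+ 2 + Wr ^+ 2 + Wz ^+ 2.
pose E := U ^+ 2 + W ^+ 2.
pose S := s ^+ 2.
rewrite -/S in N8 Le.
have S1 : 1 <= S by rewrite /S expr2; nra.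
have sS : s <= S by rewrite /S expr2; nra.
have aS : a ^+ 2 * S = 1 by rewrite /S -exprMn as1 expr1n.
have a2 : 0 <= a ^+ 2 by exact: sqr_ge0.
have E0 : 0 <= E by rewrite addr_ge0 ?sqr_ge0.
have E2 : E <= 2 by rewrite /E; nra.
have D0 : 0 <= D by rewrite !addr_ge0 ?sqr_ge0.
have iS : i ^+ 2 <= S by rewrite /S ler_sqr ?nnegrE // (le_trans i0).
have w2D : w ^+ 2 <= 2 * D.
  have := sqr_ge0 (Uz + Wr); have := sqr_ge0 Ur; have := sqr_ge0 Wz.
  rewrite wE /D; lra.
have w20 : 0 <= w ^+ 2 by exact: sqr_ge0.
have e2 : 0 <= e ^+ 2 by exact: sqr_ge0.
have ew0 : 0 <= e ^+ 2 * w ^+ 2 by exact: mulr_ge0.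
have e2le1 : e ^+ 2 <= 1 by rewrite expr_le1.
have H1 : 0 <= a ^+ 2 * (e ^+ 4 * (wr ^+ 2 + wz ^+ 2) / 2
    + 8 * e ^+ 3 * w * (er * wr + ez * wz) + 32 * (e ^+ 2 * w ^+ 2 * N)).
  rewrite [X in _ * X](_ : _ =
    e ^+ 2 / 2 * ((e * wr + 8 * w * er) ^+ 2 + (e * wz + 8 * w * ez) ^+ 2)); last first.
    by rewrite /N; field.
  by rewrite mulr_ge0 // mulr_ge0 ?divr_ge0 ?addr_ge0 ?sqr_ge0.
have H2 : a ^+ 2 * (e ^+ 2 * w ^+ 2 * N) <= 8 * (e ^+ 2 * w ^+ 2).
  rewrite mulrCA [8 * _]mulrC; apply: ler_wpM2l => //.
  by have := ler_wpM2l a2 N8; lra.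
have aL : - 10 <= a ^+ 2 * L by have := ler_wpM2l a2 Le; lra.
have H3 : - 10 * (e ^+ 2 * w ^+ 2) <= a ^+ 2 * (e ^+ 3 * w ^+ 2 * L).
  have -> : a ^+ 2 * (e ^+ 3 * w ^+ 2 * L) = e ^+ 2 * w ^+ 2 * (e * (a ^+ 2 * L)) by ring.
  rewrite [- 10 * _]mulrC; apply: ler_wpM2l => //.
  by have := ler_wpM2l e0 aL; move: e1; clear; lra.
have H4 : - (e ^+ 2 * w ^+ 2) <= a ^+ 2 * (e ^+ 4 * w ^+ 2 * (i ^+ 2 - U * i)).
  have -> : a ^+ 2 * (e ^+ 4 * w ^+ 2 * (i ^+ 2 - U * i)) =
    e ^+ 2 * w ^+ 2 * (e ^+ 2 * (a ^+ 2 * (i ^+ 2 - U * i))) by ring.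
  rewrite -[- (_ * _)]mulrN1; apply: ler_wpM2l => //.
  have h : - S <= i ^+ 2 - U * i.
    have := sqr_ge0 i; have := mulr_ge0 (_ : 0 <= 1 - U) i0; lra.
  have := ler_wpM2l a2 h; rewrite mulrN aS => h'.
  by have := ler_wpM2l e2 h'; move: e2le1; clear; lra.
(* The term [U * wz - W * wr] comes from the Laplacians of [U] and [W]. It is split by Young's
   inequality with weights [a] and [s], whose product is 1. *)
have H5 : - (a ^+ 2 * (e ^+ 4 * (wr ^+ 2 + wz ^+ 2))) / 4 - 736 ^+ 2 * (S * E) <=
    736 * (e ^+ 2 * (U * wz - W * wr)).
  have h : 0 <= (a * e ^+ 2 * wz / 2 + 736 * s * U) ^+ 2
              + (a * e ^+ 2 * wr / 2 - 736 * s * W) ^+ 2 by rewrite addr_ge0 ?sqr_ge0.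
  rewrite -subr_ge0; apply: le_trans h _; rewrite le_eqVlt; apply/orP; left; apply/eqP.
  rewrite /S /E; transitivity (a ^+ 2 * (e ^+ 4 * (wr ^+ 2 + wz ^+ 2)) / 4
    + 736 ^+ 2 * (s ^+ 2 * (U ^+ 2 + W ^+ 2)) + (a * s) * (736 * (e ^+ 2 * (U * wz - W * wr)))).
    by field.
  by rewrite as1; field.
have SE : 0 <= S * E by rewrite mulr_ge0 // (le_trans ler01).
have ESE : E <= S * E by rewrite ler_peMl.
have H6 : - (e ^+ 2 * D) / 8 - 4 * (S * E) <=
    - (e ^+ 2 * (U ^+ 2 * Ur + U * W * Uz + U * W * Wr + W ^+ 2 * Wz)).
  have h : U ^+ 2 * Ur + U * W * Uz + U * W * Wr + W ^+ 2 * Wz <= D / 8 + 4 * (S * E).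
    have h1 := sqr_ge0 (Ur - 4 * U ^+ 2); have h2 := sqr_ge0 (Uz - 4 * (U * W)).
    have h3 := sqr_ge0 (Wr - 4 * (U * W)); have h4 := sqr_ge0 (Wz - 4 * W ^+ 2).
    have h5 : E ^+ 2 <= 2 * E by rewrite expr2 ler_wpM2r.
    by move: h1 h2 h3 h4 h5 ESE; rewrite /D /E; clear; lra.
  by have := ler_wpM2l e2 h; have := ler_wpM2r SE e2le1; clear; lra.
have H7 : - (e ^+ 2 * D) / 8 - 4 * (S * E) <= - (e ^+ 2 * (W * w * i)).
  have h : W * w * i <= D / 8 + 4 * (S * E).
    have h1 := sqr_ge0 (w - 8 * (W * i)).
    have h2 : W ^+ 2 * i ^+ 2 <= S * E.
      rewrite mulrC; apply: ler_pM; rewrite ?sqr_ge0 // /E lerDr; exact: sqr_ge0.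
    by move: h1 h2 w2D; clear; lra.
  by have := ler_wpM2l e2 h; have := ler_wpM2r SE e2le1; clear; lra.
have H8 : - 10 * (S * E) <= E * (e * L + N).
  have h : - 10 * S <= e * L + N.
    have := ler_wpM2l e0 Le; have : 0 <= N by rewrite addr_ge0 ?sqr_ge0.
    have : 0 <= (1 - e) * S by rewrite mulr_ge0 ?subr_ge0 // (le_trans ler01).
    by clear; lra.
  by have := ler_wpM2l E0 h; clear; lra.
have H9 : - (e ^+ 2 * D) / 8 - 256 * (S * E) <=
    4 * e * (er * (U * Ur + W * Wr) + ez * (U * Uz + W * Wz)).
  have h1 := sqr_ge0 (e * Ur + 16 * er * U); have h2 := sqr_ge0 (e * Wr + 16 * er * W).
  have h3 := sqr_ge0 (e * Uz + 16 * ez * U); have h4 := sqr_ge0 (e * Wz + 16 * ez * W).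
  have h5 : N * E <= 8 * (S * E) by have := ler_wpM2r E0 N8; clear; lra.
  by move: h1 h2 h3 h4 h5; rewrite /N /D /E; clear; lra.
have H10 : 0 <= e ^+ 2 * (U ^+ 2 * i ^+ 2).
  by apply: mulr_ge0 => //; apply: mulr_ge0; exact: sqr_ge0.
have H11 : 0 <= a ^+ 2 * (e ^+ 4 * (wr ^+ 2 + wz ^+ 2)).
  apply: mulr_ge0 => //; apply: mulr_ge0; first exact: exprn_ge0.
  by apply: addr_ge0; exact: sqr_ge0.
have H12 : e ^+ 2 * w ^+ 2 <= 2 * (e ^+ 2 * D) by have := ler_wpM2l e2 w2D; clear; lra.
move=> EU EW Ew Pr Pz Prr Pzz Pr0 Pz0 Prr0 Pzz0.
(* With [i] in the role of [1 / r], this is the axisymmetric Laplacian of the Bernstein function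
   minus its derivative along the flow. It is nonpositive at a maximum and is rewritten here by
   means of the equations for [U], [W] and [w]. *)
have LP : a ^+ 2 * (e ^+ 4 * (wr ^+ 2 + wz ^+ 2) + e ^+ 4 * w ^+ 2 * (i ^+ 2 - U * i)
      + 8 * e ^+ 3 * w * (er * wr + ez * wz) + w ^+ 2 * (2 * e ^+ 3 * L + 6 * e ^+ 2 * N))
    + 736 * (e ^+ 2 * (D + U ^+ 2 * i ^+ 2 + U * wz - W * wr - W * w * i
        - (U ^+ 2 * Ur + U * W * Uz + U * W * Wr + W ^+ 2 * Wz))
      + E * (e * L + N) + 4 * e * (er * (U * Ur + W * Wr) + ez * (U * Uz + W * Wz))) <= 0.
  rewrite [X in X <= _](_ : _ = Prr + Pzz + (i - U) * Pr - W * Pz).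
    by rewrite Pr0 Pz0 !mulr0 addr0 subr0 -[0]addr0 lerD.
  have Ewrr : wrr = U * wr + W * wz - i * U * w - i * wr - wzz + i ^+ 2 * w by rewrite -Ew; ring.
  have EUrr : Urr = wz - i * Ur - Uzz + i ^+ 2 * U by rewrite -EU; ring.
  have EWrr : Wrr = - (wr + i * w) - i * Wr - Wzz by rewrite -EW; ring.
  by rewrite /Prr /Pzz /Pr /Pz Ewrr EUrr EWrr /L /N /D /E; field.
clear Pr0 Pz0 Prr0 Pzz0 Pr Pz Prr Pzz EU EW Ew.
rewrite -/S -/E.
clearbody L N D E S.
(* The balance is as follows. [H6], [H7] and [H9] each cost one eighth of [736 * e ^+ 2 * D]; the
   remaining [460 * e ^+ 2 * D] is at least [230 * e ^+ 2 * w ^+ 2]. The errors in [e ^+ 2 * w ^+ 2]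
   are 208 from [H1] and [H2] (32 - 6 = 26 times 8), 20 from [H3] and 1 from [H4], that is 229. Of
   the gradient of [w], [H1] uses one half and [H5] one quarter. The coefficient of [S * E] is 736 *
   (736 + 4 + 4 + 10 + 256) = 736 * 1010. *)
by move: LP H1 H2 H3 H4 H5 H6 H7 H8 H9 H10 H11 H12; clear; lra.
Qed.

Lemma sqr_le1_itv (R : realDomainType) (x y : R) :
  x ^+ 2 + y ^+ 2 <= 1 -> -1 <= x <= 1.
Proof.
move=> h; rewrite -ler_norml -(@expr_le1 _ 2) // real_normK ?num_real //.
by apply: le_trans h; rewrite lerDl sqr_ge0.
Qed.

Section VorticityBound.
Context {R : realType}.

(* [U], [W] and [w] are the radial velocity, the axial velocity and the vorticity
   of a steady axisymmetric flow without swirl, in the half plane [0 < r]; the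
   pressure is eliminated. *)
Record axiflow (U W w : @jet R) : Prop := AxiFlow {
  axi_U : jet_ok U;
  axi_W : jet_ok W;
  axi_w : jet_ok w;
  axi_div : forall r z : R, 0 < r -> j1 U r z + r^-1 * jv U r z + j2 W r z = 0;
  axi_curl : forall r z : R, 0 < r -> jv w r z = j2 U r z - j1 W r z;
  axi_lapU : forall r z : R, 0 < r ->
    j11 U r z + r^-1 * j1 U r z + j22 U r z - r^-1 ^+ 2 * jv U r z = j2 w r z;
  axi_lapW : forall r z : R, 0 < r ->
    j11 W r z + r^-1 * j1 W r z + j22 W r z = - (j1 w r z + r^-1 * jv w r z);
  axi_vorticity : forall r z : R, 0 < r ->
    j11 w r z + r^-1 * j1 w r z + j22 w r z - r^-1 ^+ 2 * jv w r z =
    jv U r z * j1 w r z + jv W r z * j2 w r z - r^-1 * jv U r z * jv w r z }.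

(** The maximum principle is applied to the Bernstein function minus a constant [K], which is
    nonpositive on the boundary because [eta] vanishes there. The condition [s^-1 <= ra] keeps the
    coefficient [1 / r] between 0 and [s]. *)
Lemma bernstein_bound (U W w eta : jet) (a s M ra rb za zb : R) :
  axiflow U W w -> jet_ok eta -> a * s = 1 -> 1 <= s -> s^-1 <= ra ->
  ra <= rb -> za <= zb -> 0 <= M <= 1 ->
  (forall r z, ra <= r <= rb -> za <= z <= zb -> jv U r z ^+ 2 + jv W r z ^+ 2 <= M) ->
  (forall r z, ra <= r <= rb -> za <= z <= zb -> 0 <= jv eta r z <= 1) ->
  (forall z, za <= z <= zb -> jv eta ra z = 0 /\ jv eta rb z = 0) ->
  (forall r, ra <= r <= rb -> jv eta r za = 0 /\ jv eta r zb = 0) ->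
  (forall r z, ra <= r <= rb -> za <= z <= zb ->
    j1 eta r z ^+ 2 + j2 eta r z ^+ 2 <= 8 * s ^+ 2) ->
  (forall r z, ra <= r <= rb -> za <= z <= zb ->
    - 10 * s ^+ 2 <= j11 eta r z + j22 eta r z + r^-1 * j1 eta r z
      - jv U r z * j1 eta r z - jv W r z * j2 eta r z) ->
  forall r z, ra <= r <= rb -> za <= z <= zb ->
    a ^+ 2 * (jv eta r z ^+ 4 * jv w r z ^+ 2) <= 900 ^+ 2 * M.
Proof.
move=> [oU oW ow _ curl lapU lapW vor] oe as1 s1 sra rab zab /andP[M0 M1] UM e01
  etar etaz grad lap r z hr hz.
have s0 : 0 < s by lra.
have ra0 : 0 < ra by apply: lt_le_trans sra; rewrite invr_gt0.
(* At an interior maximum the pointwise estimate times [a ^+ 2] bounds the Bernstein function by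
   (736 * 505 + 368) * E with E = U^2 + W^2 <= M, which is less than 736 * 506 * M. In the end 2 *
   736 * 506 = 744832 is below 900^2 = 810000. *)
have [K KE] : {K | K = 736 * 506 * M} by exists (736 * 506 * M).
have K0 : 0 <= K by rewrite KE; lra.
pose P := jet_add (jet_mul (jet_cst (a ^+ 2 / 2))
    (jet_mul (jet_mul (jet_mul eta eta) (jet_mul eta eta)) (jet_mul w w)))
  (jet_mul (jet_cst 368) (jet_mul (jet_mul eta eta) (jet_add (jet_mul U U) (jet_mul W W)))).
have oP : jet_ok (jet_add P (jet_cst (- K))).
  by do ![apply: jet_add_ok|apply: jet_mul_ok|exact: jet_cst_ok|].
have bd x y : jv eta x y = 0 -> jv (jet_add P (jet_cst (- K))) x y <= 0.
  by move=> e0; rewrite /= e0 !(mul0r, mulr0, add0r) oppr_le0.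
have := jet_max oP ra0 rab zab (fun y hy => bd _ _ (etar y hy).1)
  (fun y hy => bd _ _ (etar y hy).2) (fun x hx => bd _ _ (etaz x hx).1)
  (fun x hx => bd _ _ (etaz x hx).2).
move=> /(_ _ r z hr hz) H; have : jv P r z <= K.
  rewrite -subr_le0; apply: H => {hr hz bd}{}r {}z r' z' Ppos P1 P2 P11 P22.
  have hr : ra <= r <= rb by lra.
  have hz : za <= z <= zb by lra.
  have r0 : 0 < r by lra.
  have ris : 0 <= r^-1 <= s.
    rewrite invr_ge0 ltW //= -[s]invrK lef_pV2 ?posrE ?invr_gt0 //.
    by apply: le_trans sra _; lra.
  have UW := UM _ _ hr hz.
  have U1 : -1 <= jv U r z <= 1.
    by apply: (@sqr_le1_itv _ _ (jv W r z)); exact: le_trans M1.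
  have W1 : -1 <= jv W r z <= 1.
    by apply: (@sqr_le1_itv _ _ (jv U r z)); rewrite addrC; exact: le_trans M1.
  have B := @bernstein_pointwise R a s r^-1 _ _ _ _ _ _ _ _ _ _ _ _ (j2 W r z)
    _ _ _ _ _ _ _
    as1 s1 ris (e01 _ _ hr hz) (grad _ _ hr hz) (lap _ _ hr hz)
    U1 W1 (curl r z r0) (lapU r z r0) (lapW r z r0) (vor r z r0).
  have {B} : jv eta r z ^+ 2 * jv w r z ^+ 2 <=
      736 * 1010 * (s ^+ 2 * (jv U r z ^+ 2 + jv W r z ^+ 2)).
    apply: B.
    - by apply: etrans P1; rewrite /=; field.
    - by apply: etrans P2; rewrite /=; field.
    - apply: le_trans P11; rewrite le_eqVlt; apply/orP; left; apply/eqP.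
      by rewrite /=; field.
    - apply: le_trans P22; rewrite le_eqVlt; apply/orP; left; apply/eqP.
      by rewrite /=; field.
  have {ris U1 W1 P1 P2 P11 P22} := e01 _ _ hr hz => /andP[e0 e1].
  move: Ppos UW; rewrite /= KE.
  set e := jv eta r z in e0 e1 *; set y := jv w r z; set u := jv U r z; set v := jv W r z.
  set E := u ^+ 2 + v ^+ 2 => Ppos UW B.
  have E0 : 0 <= E by rewrite addr_ge0 ?sqr_ge0.
  have e2 : e ^+ 2 <= 1 by rewrite expr_le1.
  have e20 : 0 <= e ^+ 2 by exact: sqr_ge0.
  have h1 : a ^+ 2 * (e ^+ 2 * y ^+ 2) <= 736 * 1010 * E.
    have := ler_wpM2l (sqr_ge0 a) B.
    have -> : a ^+ 2 * (736 * 1010 * (s ^+ 2 * E)) = (a * s) ^+ 2 * (736 * 1010 * E) by ring.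
    by rewrite as1 expr1n mul1r.
  have h2 : e ^+ 2 * (a ^+ 2 * (e ^+ 2 * y ^+ 2)) <= a ^+ 2 * (e ^+ 2 * y ^+ 2).
    by rewrite ler_piMl // mulr_ge0 ?sqr_ge0 // mulr_ge0 ?sqr_ge0.
  have h3 : e ^+ 2 * E <= E by rewrite ler_piMl.
  move: Ppos UW h1 h2 h3 E0; rewrite -!expr2 -/E; clear.
  have -> : a ^+ 2 / 2 * (e ^+ 2 ^+ 2 * y ^+ 2) = e ^+ 2 * (a ^+ 2 * (e ^+ 2 * y ^+ 2)) / 2.
    by field.
  move: (e ^+ 2 * (a ^+ 2 * (e ^+ 2 * y ^+ 2))) (a ^+ 2 * (e ^+ 2 * y ^+ 2)) (e ^+ 2 * E) => x1 x2 x3.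
  clearbody E; lra.
rewrite /P /= -!expr2 KE => {}H.
have : 0 <= jv eta r z ^+ 2 * (jv U r z ^+ 2 + jv W r z ^+ 2).
  by rewrite mulr_ge0 ?addr_ge0 ?sqr_ge0.
have -> : jv eta r z ^+ 4 = jv eta r z ^+ 2 ^+ 2 by rewrite -exprM.
move: H M0; move: (jv eta r z ^+ 2 ^+ 2 * _) (jv eta r z ^+ 2 * _) => x1 x2; clear.
lra.
Qed.

End VorticityBound.

(** * The polynomial cutoff of a square *)

Section Cutoff.
Context {R : realType}.

(** The cutoff is the product of 1 - s^2 (r - r0)^2 and 1 - s^2 (z - z0)^2 with s = 1 / a: it is 1
    at the centre and 0 on the sides of the square. The condition [2 * a <= r0] keeps the square at
    distance at least [a] from the axis. *)
Lemma vorticity_bound (U W w : jet) (a M r0 z0 : R) :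
  axiflow U W w -> 0 < a <= 1 -> 2 * a <= r0 -> 0 <= M <= 1 ->
  (forall r z, r0 - a <= r <= r0 + a -> z0 - a <= z <= z0 + a ->
    jv U r z ^+ 2 + jv W r z ^+ 2 <= M) ->
  (a * jv w r0 z0) ^+ 2 <= 900 ^+ 2 * M.
Proof.
move=> flow /andP[a0 a1] ar0 M01 UM.
pose s := a^-1.
have as1 : a * s = 1 by rewrite mulfV // gt_eqF.
have s0 : 0 < s by rewrite invr_gt0.
have s1 : 1 <= s by rewrite -invr1 lef_pV2 ?posrE.
pose cut (x : jet) (c : R) := jet_add (jet_cst 1) (jet_mul (jet_cst (- s ^+ 2))
  (jet_mul (jet_add x (jet_cst (- c))) (jet_add x (jet_cst (- c))))).
pose eta := jet_mul (cut jet_r r0) (cut jet_z z0).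
pose X r := 1 - (s * (r - r0)) ^+ 2.
pose Y z := 1 - (s * (z - z0)) ^+ 2.
have oc x c : jet_ok x -> jet_ok (cut x c).
  move=> ox; have := jet_cst_ok (R := R) => oc.
  by do ![apply: jet_add_ok|apply: jet_mul_ok|exact: jet_cst_ok|].
have oe : jet_ok eta.
  by apply: jet_mul_ok; apply: oc; [exact: jet_r_ok|exact: jet_z_ok].
have e0 r z : jv eta r z = X r * Y z by rewrite /= /X /Y; ring.
have e1 r z : j1 eta r z = - 2 * s * (s * (r - r0)) * Y z by rewrite /= /Y; ring.
have e2 r z : j2 eta r z = - 2 * s * (s * (z - z0)) * X r by rewrite /= /X; ring.
have e11 r z : j11 eta r z = - 2 * s ^+ 2 * Y z by rewrite /= /Y; ring.
have e22 r z : j22 eta r z = - 2 * s ^+ 2 * X r by rewrite /= /X; ring.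
have sb c x : c - a <= x <= c + a -> -1 <= s * (x - c) <= 1.
  move=> hx; rewrite -ler_norml normrM gtr0_norm // -as1 [a * s]mulrC.
  by rewrite ler_pM2l // ler_norml; lra.
have XY c x : c - a <= x <= c + a -> 0 <= 1 - (s * (x - c)) ^+ 2 <= 1.
  move=> /sb; rewrite -ler_norml => h.
  by rewrite subr_ge0 gerBl sqr_ge0 andbT -real_normK ?num_real // expr_le1.
have a_lt_r0 : 0 < r0 - a by lra.
have Xe : X (r0 - a) = 0 /\ X (r0 + a) = 0.
  split; rewrite /X.
    have -> : s * (r0 - a - r0) = - (a * s) by ring.
    by rewrite as1 sqrrN expr1n subrr.
  have -> : s * (r0 + a - r0) = a * s by ring.
  by rewrite as1 expr1n subrr.
have Ye : Y (z0 - a) = 0 /\ Y (z0 + a) = 0.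
  split; rewrite /Y.
    have -> : s * (z0 - a - z0) = - (a * s) by ring.
    by rewrite as1 sqrrN expr1n subrr.
  have -> : s * (z0 + a - z0) = a * s by ring.
  by rewrite as1 expr1n subrr.
have sra : s^-1 <= r0 - a by rewrite invrK; lra.
have rab : r0 - a <= r0 + a by lra.
have zab : z0 - a <= z0 + a by lra.
have H := bernstein_bound flow oe as1 s1 sra rab zab M01 UM.
have {H} : a ^+ 2 * (jv eta r0 z0 ^+ 4 * jv w r0 z0 ^+ 2) <= 900 ^+ 2 * M.
  apply: H => [r z hr hz|z hz|r hr|r z hr hz|r z hr hz||].
  - rewrite e0; have /andP[x0 x1] := XY r0 r hr; have /andP[y0 y1] := XY z0 z hz.
    by rewrite mulr_ge0 //= mulr_ile1.
  - by rewrite !e0 Xe.1 Xe.2 !mul0r.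
  - by rewrite !e0 Ye.1 Ye.2 !mulr0.
  - rewrite e1 e2.
    have {}hx := sb r0 r hr; have {}hy := sb z0 z hz.
    have hX := XY r0 r hr; have hY := XY z0 z hz.
    have sq1 (x : R) : -1 <= x <= 1 -> x ^+ 2 <= 1.
      by rewrite -ler_norml => h; rewrite -real_normK ?num_real // expr_le1.
    have -> : (- 2 * s * (s * (r - r0)) * Y z) ^+ 2 + (- 2 * s * (s * (z - z0)) * X r) ^+ 2
      = 4 * s ^+ 2 * ((s * (r - r0)) ^+ 2 * Y z ^+ 2 + (s * (z - z0)) ^+ 2 * X r ^+ 2).
      by ring.
    have -> : 8 * s ^+ 2 = 4 * s ^+ 2 * (1 + 1) by ring.
    apply: ler_wpM2l; first by rewrite mulr_ge0 ?sqr_ge0.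
    have hX' : -1 <= X r <= 1 by rewrite /X; move: hX; clear; lra.
    have hY' : -1 <= Y z <= 1 by rewrite /Y; move: hY; clear; lra.
    by apply: lerD; apply: mulr_ile1; rewrite ?sqr_ge0 // sq1.
  (* The constant 10 splits as 4 from the second derivatives, 2 from the term with [1 / r], and 2
     from each component of the drift. The drift terms are of order [s] and are absorbed by
     [s <= s ^+ 2]. *)
  - rewrite e11 e22 e1 e2.
    have hx := sb r0 r hr; have hy := sb z0 z hz.
    have hX := XY r0 r hr; have hY := XY z0 z hz.
    have UM1 := UM r z hr hz; have M1 := (andP M01).2.
    have U1 : -1 <= jv U r z <= 1.
      by apply: (@sqr_le1_itv _ _ (jv W r z)); exact: le_trans M1.
    have W1 : -1 <= jv W r z <= 1.
      by apply: (@sqr_le1_itv _ _ (jv U r z)); rewrite addrC; exact: le_trans M1.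
    have r_gt0 : 0 < r by lra.
    have i1 : 0 <= r^-1 <= s.
      by rewrite invr_ge0 ltW //= lef_pV2 ?posrE //; lra.
    have prod1 (x y z1 : R) : -1 <= x <= 1 -> -1 <= y <= 1 -> 0 <= z1 <= 1 ->
        -1 <= x * y * z1 <= 1.
      rewrite -!ler_norml => hx1 hy1 /andP[z10 z11].
      by rewrite normrM mulr_ile1 ?normr_ge0 // ?normrM ?mulr_ile1 ?normr_ge0 // ger0_norm.
    have h1 := prod1 _ _ _ U1 hx hY; have h2 := prod1 _ _ _ W1 hy hX.
    have h3 : r^-1 * (s * (r - r0)) * Y z <= s.
      have /andP[Y0 Y1] : 0 <= Y z <= 1 by [].
      have [xle|xge] := leP (s * (r - r0)) 0.
        apply: le_trans (ltW s0); rewrite mulr_le0_ge0 // mulr_ge0_le0 //.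
        by case/andP: i1.
      have /andP[i0 is_] := i1; have /andP[_ p1] := hx.
      rewrite -[leRHS]mulr1; apply: ler_pM => //; first by rewrite mulr_ge0 // ltW.
      by rewrite -[leRHS]mulr1; apply: ler_pM => //; exact: ltW.
    have {}h3 := ler_wpM2l (ltW s0) h3; move: h1 h2 h3 hX hY s1; rewrite -/(Y z) -/(X r).
    move: (jv U r z) (jv W r z) (X r) (Y z) (s * (r - r0)) (s * (z - z0)) r^-1 => u v x y p q i.
    move=> {}h1 {}h2 {}h3 {}hX {}hY {}s1; clear -h1 h2 h3 hX hY s1.
    have s2 : s <= s ^+ 2 by rewrite expr2 ler_peMl //; lra.
    have /andP[g1 _] := h1; have /andP[g2 _] := h2.
    have s0 : 0 <= s by lra.
    have := ler_wpM2l s0 g1; have := ler_wpM2l s0 g2.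
    have /andP[_ k1] := hX; have /andP[_ k2] := hY.
    have := ler_wpM2l (sqr_ge0 s) k1; have := ler_wpM2l (sqr_ge0 s) k2.
    lra.
  - by lra.
  - by lra.
by rewrite e0 /X /Y !subrr mulr0 expr0n /= subr0 mulr1 expr1n mul1r -exprMn.
Qed.

End Cutoff.

(** * Comparison with supersolutions *)

Section Comparison.
Context {R : realType}.
Implicit Types (b c : R -> R -> R) (f V Z : @jet R).

(* The axisymmetric Laplacian of R^5 with drift. *)
Definition lap5 b c f (r z : R) : R :=
  j11 f r z + 3 * r^-1 * j1 f r z + j22 f r z - b r z * j1 f r z - c r z * j2 f r z.

(** At a positive interior maximum of [f - V] the gradients agree, so all first-order terms cancel,
    and the second derivatives give [lap5 f <= lap5 V]. The strict sign for [V] contradicts this,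
    whatever the size of the drift. *)
Lemma comparison b c f V (ra rb za zb : R) :
  jet_ok f -> jet_ok V -> 0 < ra -> ra <= rb -> za <= zb ->
  (forall r z, ra < r < rb -> za < z < zb -> lap5 b c f r z = 0) ->
  (forall r z, ra < r < rb -> za < z < zb -> lap5 b c V r z < 0) ->
  (forall z, za <= z <= zb -> jv f ra z <= jv V ra z) ->
  (forall z, za <= z <= zb -> jv f rb z <= jv V rb z) ->
  (forall r, ra <= r <= rb -> jv f r za <= jv V r za) ->
  (forall r, ra <= r <= rb -> jv f r zb <= jv V r zb) ->
  forall r z, ra <= r <= rb -> za <= z <= zb -> jv f r z <= jv V r z.
Proof.
move=> of_ oV ra0 rab zab Lf LV fa fb fc fd r z hr hz.
have sub x y : jv (jet_add f (jet_opp V)) x y = jv f x y - jv V x y.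
  by rewrite /= mulN1r.
rewrite -subr_le0 -sub.
apply: (jet_max (jet_add_ok of_ (jet_opp_ok oV)) ra0 rab zab) => // {r z hr hz}.
- by move=> z hz; rewrite sub subr_le0 fa.
- by move=> z hz; rewrite sub subr_le0 fb.
- by move=> r hr; rewrite sub subr_le0 fc.
- by move=> r hr; rewrite sub subr_le0 fd.
move=> r z hr hz _ /=; rewrite !mul0r !mulN1r !(mulr0, add0r) => e1 e2 h11 h22.
have := Lf r z hr hz; have := LV r z hr hz; rewrite /lap5.
have -> : j1 f r z = j1 V r z by lra.
have -> : j2 f r z = j2 V r z by lra.
lra.
Qed.

(** The axis is removed by comparing [f] with [V + k Z] on [ra <= r] and letting [k] tend to 0.
    Since [Z] dominates r^-2 while [f] is at most [C / r], the term [k Z] wins on the inner side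
    once [ra] is small. It also supplies the strict inequality that [V] alone may lack. *)
Lemma comparison_axis b c f V Z (C rb za zb : R) :
  jet_ok f -> jet_ok V -> jet_ok Z -> za <= zb ->
  (forall r z, 0 < r < rb -> za < z < zb -> lap5 b c f r z = 0) ->
  (forall r z, 0 < r < rb -> za < z < zb -> lap5 b c V r z <= 0) ->
  (forall r z, 0 < r < rb -> za < z < zb -> lap5 b c Z r z < 0) ->
  (forall r z, 0 < r <= rb -> za <= z <= zb -> 0 <= jv V r z) ->
  (forall r z, 0 < r <= rb -> za <= z <= zb -> r^-1 ^+ 2 <= jv Z r z) ->
  (forall r z, 0 < r <= rb -> za <= z <= zb -> jv f r z <= C * r^-1) ->
  (forall z, za <= z <= zb -> jv f rb z <= jv V rb z) ->
  (forall r, 0 < r <= rb -> jv f r za <= jv V r za) ->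
  (forall r, 0 < r <= rb -> jv f r zb <= jv V r zb) ->
  forall r z, 0 < r <= rb -> za <= z <= zb -> jv f r z <= jv V r z.
Proof.
move=> of_ oV oZ zab Lf LV LZ V0 Zr fC fb fc fd r z /andP[r0 rrb] hz.
have Z0 x y : 0 < x <= rb -> za <= y <= zb -> 0 < jv Z x y.
  move=> hx hy; apply: lt_le_trans (Zr x y hx hy).
  by rewrite exprn_gt0 // invr_gt0; case/andP: hx.
suff H k : 0 < k -> jv f r z <= jv V r z + k * jv Z r z.
  apply/ler_addgt0Pr => e e0.
  have Zp : 0 < jv Z r z by apply: Z0; rewrite ?r0.
  by have := H (e / jv Z r z); rewrite divfK ?gt_eqF // divr_gt0 //; apply.
(* The first entry keeps the given point in the domain; the second ensures [C * ra <= k], that is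
   [C / ra <= k / ra ^+ 2]. *)
move=> k0; pose ra := Num.min r (k / (`|C| + 1)).
have C1 : 0 < `|C| + 1 by rewrite ltr_wpDl.
have ra0 : 0 < ra by rewrite lt_min r0 divr_gt0.
have rar : ra <= r by rewrite ge_min lexx.
have raC : C * ra <= k.
  apply: (@le_trans _ _ ((`|C| + 1) * ra)).
    by apply: ler_wpM2r; [exact: ltW|apply: le_trans (ler_norm C) _; rewrite lerDl].
  by rewrite mulrC -ler_pdivlMr // ge_min lexx orbT.
clearbody ra.
have valE x y : jv (jet_add V (jet_mul (jet_cst k) Z)) x y = jv V x y + k * jv Z x y by [].
have kZ x y : 0 < x <= rb -> za <= y <= zb -> jv f x y <= jv V x y ->
    jv f x y <= jv (jet_add V (jet_mul (jet_cst k) Z)) x y.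
  move=> hx hy h; rewrite valE; apply: le_trans h _.
  by rewrite lerDl mulr_ge0 // ltW // Z0.
rewrite -valE; apply: (@comparison b c _ _ ra rb za zb) => //.
- by apply: jet_add_ok => //; apply: jet_mul_ok => //; exact: jet_cst_ok.
- exact: le_trans rrb.
- by move=> x y /andP[hx1 hx2] hy; apply: Lf => //; rewrite hx2 (lt_trans ra0).
- move=> x y /andP[hx1 hx2] hy.
  have hx : 0 < x < rb by rewrite hx2 (lt_trans ra0).
  have := LV x y hx hy; have := LZ x y hx hy.
  rewrite -(pmulr_rlt0 _ k0).
  set LkZ := k * _ => h1 h2.
  have -> : lap5 b c (jet_add V (jet_mul (jet_cst k) Z)) x y = lap5 b c V x y + LkZ.
    by rewrite /lap5 /LkZ /lap5 /=; ring.
  by rewrite -[ltRHS]addr0 ler_ltD.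
- move=> y hy; have hra : 0 < ra <= rb by rewrite ra0 (le_trans rar).
  rewrite valE; apply: le_trans (fC _ _ hra hy) _.
  rewrite -[leLHS]add0r; apply: lerD; first exact: V0.
  apply: (@le_trans _ _ (k * ra^-1 ^+ 2)); last by rewrite ler_pM2l // Zr.
  have -> : C * ra^-1 = C * ra * ra^-1 ^+ 2.
    by rewrite expr2 mulrA -(mulrA C) mulfV ?mulr1 // gt_eqF.
  by rewrite ler_wpM2r // sqr_ge0.
- by move=> y hy; apply: kZ => //; [rewrite lexx andbT (lt_le_trans r0)|exact: fb].
- move=> x /andP[hx1 hx2]; apply: kZ; rewrite ?lexx ?zab ?hx2 ?(lt_le_trans ra0) //.
  by apply: fc; rewrite hx2 (lt_le_trans ra0).
- move=> x /andP[hx1 hx2]; apply: kZ; rewrite ?lexx ?zab ?hx2 ?(lt_le_trans ra0) //.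
  by apply: fd; rewrite hx2 (lt_le_trans ra0).
- by rewrite rar.
Qed.

Definition jet_rinv : @jet R := jet_inv jet_r.

Lemma jet_rinv_ok : jet_ok jet_rinv.
Proof.
by apply: jet_inv_ok; [move=> r z r0; rewrite /= gt_eqF|exact: jet_r_ok].
Qed.

(* [r^-2] is harmonic in R^4; the term [k / r] makes the barrier strict, and only
   boundedness of [r f] near the axis is needed for it to dominate [f]. *)
Definition axis_barrier (k : R) : @jet R :=
  jet_add (jet_mul jet_rinv jet_rinv) (jet_mul (jet_cst k) jet_rinv).

Lemma axis_barrier_ok k : jet_ok (axis_barrier k).
Proof.
have := jet_rinv_ok => h.
by do ![apply: jet_add_ok|apply: jet_mul_ok|exact: jet_cst_ok|].
Qed.

Lemma lap5_axis_barrier b c k (r z : R) : 0 < r ->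
  lap5 b c (axis_barrier k) r z =
  r^-1 ^+ 3 * (2 * b r z - k) + k * b r z * r^-1 ^+ 2.
Proof. by move=> r0; rewrite /lap5 /=; field; rewrite gt_eqF. Qed.

End Comparison.

(** * Vanishing of the flow in the half plane *)

Lemma norm_le_sqr (R : realDomainType) (x e : R) :
  0 <= e -> x ^+ 2 <= e ^+ 2 -> `|x| <= e.
Proof.
by move=> e0 h; rewrite -ler_sqr ?nnegrE // real_normK ?num_real.
Qed.

Lemma norm_le_sqrD (R : realDomainType) (x y e : R) :
  0 <= e -> x ^+ 2 + y ^+ 2 <= e ^+ 2 -> `|x| <= e.
Proof.
by move=> e0 h; apply: norm_le_sqr => //; apply: le_trans h; rewrite lerDl sqr_ge0.
Qed.

(** The left side bounds [lap5] of [axis_barrier (4 * K)] at [i = 1 / r] when the radial drift is at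
    most [K]. It is positive only for [i < 2 * K], so it is bounded uniformly up to the axis. *)
Lemma barrier_drift_bound (F : realFieldType) (K i : F) : 0 <= K -> 0 <= i ->
  - 2 * K * i ^+ 3 + 4 * K ^+ 2 * i ^+ 2 <= 16 * K ^+ 4.
Proof.
move=> K0 i0.
have -> : - 2 * K * i ^+ 3 + 4 * K ^+ 2 * i ^+ 2 = 2 * K * (i ^+ 2 * (2 * K - i)) by ring.
have K20 : 0 <= 2 * K by lra.
have [le|ge] := leP i (2 * K).
  have i2 : i ^+ 2 <= (2 * K) ^+ 2 by rewrite ler_sqr ?nnegrE.
  have -> : 16 * K ^+ 4 = 2 * K * ((2 * K) ^+ 2 * (2 * K)) by ring.
  by apply: ler_wpM2l => //; apply: ler_pM; rewrite ?sqr_ge0 ?subr_ge0 ?gerBl.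
apply: (@le_trans _ _ 0); last by have := exprn_ge0 4 K0; lra.
by rewrite mulr_ge0_le0 // mulr_ge0_le0 ?sqr_ge0 // subr_le0 ltW.
Qed.

Section Liouville.
Context {R : realType}.
Variables (U W w : @jet R).
Hypothesis flow : axiflow U W w.
(** This bound reaches the axis and serves to remove it: it gives |Omega| <= C / r nearby. The value
    of [C] enters none of the final estimates. *)
Hypothesis w_bounded : forall m : R, exists C : R, forall r z : R,
  0 < r <= m -> - m <= z <= m -> `|jv w r z| <= C.
Hypothesis u_decay : forall e : R, 0 < e -> exists2 m : R, 0 < m & forall r z : R,
  0 < r -> m < r \/ m < `|z| -> jv U r z ^+ 2 + jv W r z ^+ 2 <= e ^+ 2.

(* [Omega = w / r] up to sign: the two values [sg = 1, -1] give both one-sided bounds. *)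
Definition vort_ratio (sg : R) : jet := jet_mul (jet_cst sg) (jet_mul w jet_rinv).

Lemma vort_ratio_ok sg : jet_ok (vort_ratio sg).
Proof.
apply: jet_mul_ok; first exact: jet_cst_ok.
by apply: jet_mul_ok; [exact: axi_w flow|exact: jet_rinv_ok].
Qed.

(** Division by [r] removes both terms of order zero. The term w / r^2 is absorbed by the passage
    from dimension 3 to 5, and the stretching term U w / r cancels against the drift acting on 1 /
    r. *)
Lemma lap5_vort_ratio sg (r z : R) : 0 < r -> lap5 (jv U) (jv W) (vort_ratio sg) r z = 0.
Proof.
move=> r0; have := axi_vorticity flow z r0.
have rn0 : r != 0 by rewrite gt_eqF.
move=> E; have {}E : j11 w r z = jv U r z * j1 w r z + jv W r z * j2 w r z
  - r^-1 * jv U r z * jv w r z - r^-1 * j1 w r z - j22 w r z + r^-1 ^+ 2 * jv w r z.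
  by rewrite -E; ring.
by rewrite /lap5 /= E; field.
Qed.

(* The inverse of [pole p] is superharmonic in R^5 and equals [r^-2] at height [z = p],
   so that it controls [Omega] on an end of the cylinder up to the axis. *)
Definition pole (p : R) : @jet R := jet_add (jet_mul jet_r jet_r)
  (jet_mul (jet_add jet_z (jet_cst (- p))) (jet_add jet_z (jet_cst (- p)))).

Lemma pole_gt0 p r z : 0 < r -> 0 < jv (pole p) r z.
Proof.
by move=> r0; rewrite /= -!expr2 ltr_pwDl ?sqr_ge0 // exprn_gt0.
Qed.

Lemma pole_inv_ok p : jet_ok (jet_inv (pole p)).
Proof.
apply: jet_inv_ok => [r z r0|]; first by rewrite gt_eqF // pole_gt0.
by do ![apply: jet_add_ok|apply: jet_mul_ok|exact: jet_cst_ok|exact: jet_r_ok|exact: jet_z_ok].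
Qed.

(** With rho the distance to the pole, the Laplacian of rho^-2 in R^5 is -2 rho^-4. The drift adds 2
    (b r + c (z - p)) rho^-4, which the hypothesis keeps below the margin. *)
Lemma lap5_pole_inv b c p (r z : R) : 0 < r ->
  `|b r z * r + c r z * (z - p)| <= 1 -> lap5 b c (jet_inv (pole p)) r z <= 0.
Proof.
move=> r0 h; have g0 := pole_gt0 p z r0.
have -> : lap5 b c (jet_inv (pole p)) r z =
    (2 * (b r z * r + c r z * (z - p)) - 2) / jv (pole p) r z ^+ 2.
  move: g0; rewrite /lap5 /= !(mul1r, mulr1, mul0r, mulr0, add0r, addr0) => g0.
  by field; rewrite !gt_eqF.
rewrite mulr_le0_ge0 ?invr_ge0 ?sqr_ge0 //.
by move: h; rewrite ler_norml; lra.
Qed.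

Lemma vort_ratio_le (sg r z C : R) : `|sg| = 1 -> 0 < r ->
  `|jv w r z| <= C -> jv (vort_ratio sg) r z <= C * r^-1.
Proof.
move=> sg1 r0 h; apply: le_trans (ler_norm _) _.
rewrite /= normrM sg1 mul1r normrM [`|r^-1|]gtr0_norm ?invr_gt0 //.
by rewrite ler_pM2r // invr_gt0.
Qed.

(** With m = 900 e, the interior bound of half-side [r / 2] gives |Omega| <= 2 m / r^2 on the
    cylinder r <= 1, |z - z0| <= 1. The comparison function is 4 m times the sum of the two inverse
    poles. On an end, the pole there contributes 4 m / r^2; on the side r = 1, the nearer pole has
    squared distance at most 2 and contributes at least 2 m. At height [z0] both poles are at
    distance at least 1, whence 8 m. *)
Lemma near_axis_bound (z0 e : R) : 0 <= e <= 8^-1 ->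
  (forall r z : R, 0 < r <= 2 -> z0 - 2 <= z <= z0 + 2 ->
    jv U r z ^+ 2 + jv W r z ^+ 2 <= e ^+ 2) ->
  forall r, 0 < r <= 1 -> `|jv w r z0| <= 8 * (900 * e) * r.
Proof.
move=> /andP[e0 e1] UW.
have [m mE] : {m | m = 900 * e} by exists (900 * e).
have m0 : 0 <= m by rewrite mE; lra.
have e21 : 0 <= e ^+ 2 <= 1 by rewrite sqr_ge0 expr_le1 //; lra.
have wb r z : 0 < r <= 1 -> z0 - 1 <= z <= z0 + 1 -> `|jv w r z| <= 2 * m * r^-1.
  move=> /andP[r0 r1] hz.
  have r20 : 0 < r / 2 <= 1 by lra.
  have r2r : 2 * (r / 2) <= r by lra.
  have H := vorticity_bound (r0 := r) (z0 := z) flow r20 r2r e21.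
  have {H} : (r / 2 * jv w r z) ^+ 2 <= 900 ^+ 2 * e ^+ 2.
    by apply: H => x y hx hy; apply: UW; lra.
  rewrite -exprMn -mE => /(norm_le_sqr m0).
  rewrite normrM gtr0_norm ?divr_gt0 // -ler_pdivlMl ?divr_gt0 // => h.
  by apply: le_trans h _; rewrite le_eqVlt; apply/orP; left; apply/eqP; field; rewrite gt_eqF.
have vortf (sg : R) : `|sg| = 1 -> forall r, 0 < r <= 1 -> jv (vort_ratio sg) r z0 <= 8 * m.
  move=> sg1 r hr.
  pose V : jet := jet_mul (jet_cst (4 * m))
    (jet_add (jet_inv (pole (z0 - 1))) (jet_inv (pole (z0 + 1)))).
  have oV : jet_ok V.
    apply: jet_mul_ok; first exact: jet_cst_ok.
    by apply: jet_add_ok; exact: pole_inv_ok.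
  have pV x y : 0 < x -> 0 <= (jv (pole (z0 - 1)) x y)^-1 /\ 0 <= (jv (pole (z0 + 1)) x y)^-1.
    by move=> x0; rewrite !invr_ge0 !ltW ?pole_gt0.
  have VE x y : jv V x y = 4 * m * ((jv (pole (z0 - 1)) x y)^-1 + (jv (pole (z0 + 1)) x y)^-1) by [].
  have m4 : 0 <= 4 * m by lra.
  have VP1 x y : 0 < x -> 4 * m * (jv (pole (z0 - 1)) x y)^-1 <= jv V x y.
    by move=> /(pV _ y)[p1 p2]; rewrite VE ler_wpM2l // lerDl.
  have VP2 x y : 0 < x -> 4 * m * (jv (pole (z0 + 1)) x y)^-1 <= jv V x y.
    by move=> /(pV _ y)[p1 p2]; rewrite VE ler_wpM2l // lerDr.
  have [C wC] := w_bounded (`|z0| + 2).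
  have {}wC x y : 0 < x <= 1 -> z0 - 1 <= y <= z0 + 1 -> `|jv w x y| <= C.
    by move=> hx hy; apply: wC; have := ler_norm z0; have := ler_norm (- z0);
      rewrite normrN; have := normr_ge0 z0; lra.
  have UWe x y : 0 < x < 1 -> z0 - 1 < y < z0 + 1 -> `|jv U x y| <= 8^-1 /\ `|jv W x y| <= 8^-1.
    move=> hx hy; have h : jv U x y ^+ 2 + jv W x y ^+ 2 <= e ^+ 2 by apply: UW; lra.
    split; apply: le_trans e1; first exact: norm_le_sqrD h.
    by apply: (norm_le_sqrD (y := jv U x y)) => //; rewrite addrC.
  have LV x y : 0 < x < 1 -> z0 - 1 < y < z0 + 1 -> lap5 (jv U) (jv W) V x y <= 0.
    move=> hx hy; have [hU hW] := UWe x y hx hy; have /andP[x0 x1] := hx.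
    (* Both velocities are at most 1/8, the radius at most 1 and the height above or below the pole
       at most 2, so the drift stays within the margin 1. *)
    have drift p : -2 <= y - p <= 2 -> `|jv U x y * x + jv W x y * (y - p)| <= 1.
      rewrite -ler_norml => hp; apply: le_trans (ler_normD _ _) _; rewrite !normrM.
      have -> : 1 = 2^-1 * 1 + 4^-1 * 2 :> R by field.
      apply: lerD; apply: ler_pM; rewrite ?normr_ge0 //.
      - by move: hU; lra.
      - by rewrite gtr0_norm // ltW.
      - by move: hW; lra.
    have -> : lap5 (jv U) (jv W) V x y = 4 * m *
        (lap5 (jv U) (jv W) (jet_inv (pole (z0 - 1))) x y +
         lap5 (jv U) (jv W) (jet_inv (pole (z0 + 1))) x y).
      rewrite /V; move: (jet_inv (pole (z0 - 1))) (jet_inv (pole (z0 + 1))) => F G.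
      by rewrite /lap5 /=; ring.
    rewrite mulr_ge0_le0 // -[leRHS]addr0; apply: lerD; apply: lap5_pole_inv => //;
      by apply: drift; move: hy; lra.
  have LZ x y : 0 < x < 1 -> z0 - 1 < y < z0 + 1 ->
      lap5 (jv U) (jv W) (axis_barrier 1) x y < 0.
    move=> hx hy; have [hU _] := UWe x y hx hy; have /andP[x0 x1] := hx.
    rewrite lap5_axis_barrier // mul1r.
    have i1 : 1 <= x^-1 by rewrite -invr1 lef_pV2 ?posrE // ltW.
    have i2 : 1 <= x^-1 ^+ 2 by rewrite exprn_ege1.
    have i23 : x^-1 ^+ 2 <= x^-1 ^+ 3.
      by rewrite [leRHS]exprS ler_peMl // (le_trans ler01).
    move: hU; rewrite ler_norml => /andP[_ hU].
    have h1 := ler_wpM2l (le_trans ler01 i2) hU.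
    have h2 := ler_wpM2l (le_trans (le_trans ler01 i2) i23) hU.
    by move: i1 i2 i23 h1 h2; lra.
  have two_inv : m * 2 * 1 <= 4 * m * 2^-1 by lra.
  have H := @comparison_axis _ (jv U) (jv W) (vort_ratio sg) V (axis_barrier 1) C 1
    (z0 - 1) (z0 + 1) (vort_ratio_ok sg) oV (axis_barrier_ok 1).
  have {}H : jv (vort_ratio sg) r z0 <= jv V r z0.
    apply: H => //; [lra|..|lra].
    - by move=> x y /andP[x0 _] _; exact: lap5_vort_ratio.
    - by move=> x y /andP[x0 _] _; have [p1 p2] := pV x y x0; rewrite VE mulr_ge0 // addr_ge0.
    - move=> x y /andP[x0 _] _; rewrite /= mul1r expr2 lerDl invr_ge0; exact: ltW.
    - by move=> x y hx hy; apply: vort_ratio_le => //; [case/andP: hx|exact: wC].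
    - move=> y hy; have w1 : `|jv w 1 y| <= 2 * m * 1^-1 by apply: wb => //; rewrite ltr01 lexx.
      apply: le_trans (vort_ratio_le sg1 ltr01 w1) _; rewrite invr1 !mulr1.
      have hp p : -1 <= y - p <= 1 -> 2 * m <= 4 * m * (jv (pole p) 1 y)^-1.
        rewrite -ler_norml => hp.
        have h2 : jv (pole p) 1 y <= 2.
          rewrite /= mul1r -expr2 -real_normK ?num_real //.
          have : `|y - p| ^+ 2 <= 1 by rewrite expr_le1.
          by move=> h; rewrite -[2]/(1 + 1) lerD2l.
        have : 2^-1 <= (jv (pole p) 1 y)^-1 by rewrite lef_pV2 ?posrE // pole_gt0.
        by move=> h; have := ler_wpM2l m4 h; lra.
      have [yz|yz] := leP y z0.
        by apply: le_trans (VP1 1 y ltr01); apply: hp; lra.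
      by apply: le_trans (VP2 1 y ltr01); apply: hp; lra.
    - move=> x hx; have /andP[x0 _] := hx.
      have w1 : `|jv w x (z0 - 1)| <= 2 * m * x^-1 by apply: wb => //; lra.
      apply: le_trans (vort_ratio_le sg1 x0 w1) _.
      apply: le_trans (VP1 _ _ x0); rewrite /= subrr mulr0 addr0 invfM mulrA.
      by rewrite !ler_wpM2r ?invr_ge0 ?(ltW x0) //; lra.
    - move=> x hx; have /andP[x0 _] := hx.
      have w1 : `|jv w x (z0 + 1)| <= 2 * m * x^-1 by apply: wb => //; lra.
      apply: le_trans (vort_ratio_le sg1 x0 w1) _.
      apply: le_trans (VP2 _ _ x0); rewrite /= subrr mulr0 addr0 invfM mulrA.
      by rewrite !ler_wpM2r ?invr_ge0 ?(ltW x0) //; lra.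
  apply: le_trans H _; rewrite VE.
  have hp p : (z0 - p) * (z0 - p) = 1 -> (jv (pole p) r z0)^-1 <= 1.
    move=> hp; rewrite -[leRHS]invr1 lef_pV2 ?posrE ?pole_gt0 //; last by case/andP: hr.
    by rewrite /= hp lerDr -expr2 sqr_ge0.
  have h1 : (jv (pole (z0 - 1)) r z0)^-1 <= 1 by apply: hp; ring.
  have h2 : (jv (pole (z0 + 1)) r z0)^-1 <= 1 by apply: hp; ring.
  by have := ler_wpM2l m4 (lerD h1 h2); lra.
move=> r hr; have /andP[r0 r1] := hr; rewrite -mE.
have h1 : 1 * (jv w r z0 * r^-1) <= 8 * m by apply: vortf => //; exact: normr1.
have h2 : -1 * (jv w r z0 * r^-1) <= 8 * m.
  by apply: vortf => //; rewrite normrN normr1.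
rewrite -ler_pdivrMr //.
have -> : `|jv w r z0| / r = `|jv w r z0 / r| by rewrite normf_div [`|r|]gtr0_norm.
rewrite ler_norml; lra.
Qed.


(** The weight [r] on the right expresses the decay of Omega itself. For [r <= 1] it comes from the
    bound near the axis; for [r > 1] the interior bound with half-side 1/2 suffices, since
    [d <= d * r]. The margin 3 keeps the cylinders and squares used inside the region where [u] is
    small. *)
Lemma vorticity_decay (d : R) : 0 < d -> exists2 m : R, 0 < m & forall r z : R,
  0 < r -> m < r \/ m < `|z| -> `|jv w r z| <= d * r.
Proof.
move=> d0; pose e := Num.min 8^-1 (d / (8 * 900)).
have e0 : 0 < e by rewrite lt_min; apply/andP; split; lra.
have e8 : e <= 8^-1 by rewrite ge_min lexx.
have ed : e <= d / (8 * 900) by rewrite ge_min lexx orbT.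
clearbody e.
have {}ed : 8 * (900 * e) <= d by lra.
have [m m0 UW] := u_decay e0.
exists (m + 3) => [|r z r0 far]; first by lra.
have [r1|r1] := leP r 1.
  have zfar : m + 3 < `|z| by case: far => // h; lra.
  apply: le_trans (_ : _ <= 8 * (900 * e) * r) _; last by rewrite ler_pM2r.
  apply: near_axis_bound; rewrite ?r0 ?e8 ?(ltW e0) // => x y /andP[x0 _] hy.
  apply: UW => //; right.
  have : `|z| <= `|y| + `|z - y| by rewrite -lerBlDl lerB_dist.
  have : `|z - y| <= 2 by rewrite ler_norml; lra.
  lra.
have e21 : 0 <= e ^+ 2 <= 1 by rewrite sqr_ge0 expr_le1 ?(ltW e0) //; lra.
have h20 : 0 < (2^-1 : R) <= 1 by lra.
have hr : 2 * 2^-1 <= r by lra.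
have H := vorticity_bound (r0 := r) (z0 := z) flow h20 hr e21.
have {H} : (2^-1 * jv w r z) ^+ 2 <= 900 ^+ 2 * e ^+ 2.
  apply: H => x y hx hy; apply: UW; first by lra.
  case: far => h; [left; lra|right].
  have : `|z| <= `|y| + `|z - y| by rewrite -lerBlDl lerB_dist.
  have : `|z - y| <= 2^-1 by rewrite ler_norml; lra.
  lra.
have e900 : 0 <= 900 * e by lra.
rewrite -exprMn => /(norm_le_sqr e900).
rewrite normrM gtr0_norm ?invr_gt0 ?ltr0n // => h.
apply: le_trans (_ : _ <= d * 1) _; first by lra.
by rewrite ler_pM2l // ltW.
Qed.

Hypothesis u_bounded : exists K : R, forall r z : R, 0 < r ->
  `|jv U r z| <= K /\ `|jv W r z| <= K.

Lemma vorticity_eq0 (r z : R) : 0 < r -> jv w r z = 0.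
Proof.
move=> r0.
have [K K1 UK] : exists2 K : R, 1 <= K &
    forall r z : R, 0 < r -> `|jv U r z| <= K /\ `|jv W r z| <= K.
  have [K UK] := u_bounded; exists (`|K| + 1); first by rewrite lerDr.
  move=> x y x0; have [hU hW] := UK x y x0; have := ler_norm K.
  by split; lra.
suff H (sg : R) : `|sg| = 1 -> forall d, 0 < d -> jv (vort_ratio sg) r z <= d.
  have h1 : 1 * (jv w r z * r^-1) <= 0.
    by apply/ler_addgt0Pr => e e0; rewrite add0r; apply: (H 1) => //; exact: normr1.
  have h2 : -1 * (jv w r z * r^-1) <= 0.
    apply/ler_addgt0Pr => e e0; rewrite add0r; apply: (H (-1)) => //.
    by rewrite normrN normr1.
  have /eqP : jv w r z * r^-1 = 0 by lra.
  by rewrite mulf_eq0 invr_eq0 [r == 0]gt_eqF // orbF => /eqP.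
move=> sg1 d d0; have [m m0 far] := vorticity_decay d0.
(* The cylinder of radius and half-height [rb] contains the given point, and its outer boundary lies
   where |Omega| <= d. *)
pose rb := m + r + `|z| + 1.
have z0 := normr_ge0 z.
have mb : m < rb by rewrite /rb; lra.
have rb0 : 0 < rb by lra.
(* The drift is bounded by [K] but not small, so [axis_barrier (4 * K)] satisfies only
   [lap5 <= 16 * K ^+ 4]. The term [G], equal to T (exp (p rb) - exp (p z)), corrects this:
   [p = K + 1] gives p (p - W) >= 1, and the factor exp (p rb) in [T] compensates exp (p z) down to
   z = -rb, so that [lap5 G <= - (16 * K ^+ 4 + 1)]. For z <= rb, [G] is nonnegative. *)
pose p := K + 1.
pose T := (16 * K ^+ 4 + 1) * expR (p * rb).
pose G : jet := jet_add (jet_cst (T * expR (p * rb))) (jet_mul (jet_cst (- T)) (jet_expz p)).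
pose Z := jet_add (axis_barrier (4 * K)) G.
have T0 : 0 <= T.
  by rewrite mulr_ge0 ?expR_ge0 // addr_ge0 // mulr_ge0 ?exprn_ge0 ?ler0n //; lra.
have p0 : 0 < p by rewrite /p; lra.
have oZ : jet_ok Z.
  apply: jet_add_ok; first exact: axis_barrier_ok.
  apply: jet_add_ok; first exact: jet_cst_ok.
  by apply: jet_mul_ok; [exact: jet_cst_ok|exact: jet_expz_ok].
have [C wC] := w_bounded rb.
have farf x y : 0 < x -> m < x \/ m < `|y| -> jv (vort_ratio sg) x y <= d.
  move=> x0 hfar; have h := far x y x0 hfar.
  by apply: le_trans (vort_ratio_le sg1 x0 h) _; rewrite mulfK // gt_eqF.
apply: (@comparison_axis _ (jv U) (jv W) (vort_ratio sg) (jet_cst d) Z C rb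
  (- rb) rb (vort_ratio_ok sg) (jet_cst_ok d) oZ).
- lra.
- by move=> x y /andP[x0 _] _; exact: lap5_vort_ratio.
- by move=> x y _ _; rewrite /lap5 /= !mulr0 !addr0 !subr0.
- move=> x y /andP[x0 xb] /andP[yb1 yb2].
  have [hU hW] := UK x y x0.
  have -> : lap5 (jv U) (jv W) Z x y = lap5 (jv U) (jv W) (axis_barrier (4 * K)) x y
      - T * (p * (p - jv W x y)) * expR (p * y).
    rewrite /Z; move: (axis_barrier _) => B; rewrite /lap5 /=; ring.
  rewrite lap5_axis_barrier //.
  have i0 : 0 < x^-1 by rewrite invr_gt0.
  have i30 : 0 <= x^-1 ^+ 3 by rewrite exprn_ge0 // ltW.
  have i20 : 0 <= x^-1 ^+ 2 by rewrite exprn_ge0 // ltW.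
  move: hU hW; rewrite !ler_norml => /andP[_ hU] /andP[_ hW].
  have A : x^-1 ^+ 3 * (2 * jv U x y - 4 * K) + 4 * K * jv U x y * x^-1 ^+ 2 <= 16 * K ^+ 4.
    have h1 := ler_wpM2l i30 hU.
    have K40 : 0 <= 4 * K by lra.
    have h2 := ler_wpM2l (mulr_ge0 K40 i20) hU.
    have h3 := barrier_drift_bound (le_trans ler01 K1) (ltW i0).
    move: h1 h2 h3; rewrite !mulrDr; lra.
  have B : 16 * K ^+ 4 + 1 <= T * (p * (p - jv W x y)) * expR (p * y).
    have pw : 1 <= p * (p - jv W x y).
      by rewrite -[leLHS]mulr1; apply: ler_pM => //; rewrite /p; lra.
    have E1 : 1 <= expR (p * rb) * expR (p * y).
      rewrite -expRD -mulrDr; apply: le_trans (expR_ge1Dx _).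
      by rewrite lerDl mulr_ge0 //; lra.
    have K4 : 0 <= 16 * K ^+ 4 + 1.
      by rewrite addr_ge0 // mulr_ge0 ?exprn_ge0 ?ler0n //; lra.
    have -> : T * (p * (p - jv W x y)) * expR (p * y) = (16 * K ^+ 4 + 1) *
      (p * (p - jv W x y) * (expR (p * rb) * expR (p * y))) by rewrite /T; ring.
    rewrite -[leLHS]mulr1 ler_wpM2l // -[leLHS]mulr1; apply: ler_pM => //.
  by move: A B; lra.
- by move=> x y _ _; exact: ltW.
- move=> x y /andP[x0 _] /andP[_ yb].
  have -> : jv Z x y = x^-1 ^+ 2 + (4 * K * x^-1 + T * (expR (p * rb) - expR (p * y))).
    by rewrite /=; ring.
  rewrite lerDl addr_ge0 //; first by rewrite mulr_ge0 ?invr_ge0 ?(ltW x0) //; lra.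
  by rewrite mulr_ge0 // subr_ge0 ler_expR ler_pM2l.
- by move=> x y hx hy; apply: vort_ratio_le => //; [case/andP: hx|exact: wC].
- by move=> y _; apply: farf => //; left.
- by move=> x /andP[x0 _]; apply: farf => //; right; rewrite normrN gtr0_norm.
- by move=> x /andP[x0 _]; apply: farf => //; right; rewrite gtr0_norm.
- by rewrite r0 /= /rb; lra.
- have := ler_norm z; have := ler_norm (- z); rewrite normrN /rb; lra.
Qed.

(** Once the vorticity vanishes, the equation for [U] says that U / r is harmonic in R^5, without
    drift. The comparison function is d / r rather than a constant, because on the ends of the
    cylinder |U| <= d bounds U / r only by d / r. It is superharmonic, with Laplacian -d / r^3. *)
Lemma radial_velocity_eq0 (r z : R) : 0 < r -> jv U r z = 0.
Proof.
move=> r0; have [K UK] := u_bounded.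
pose b0 : R -> R -> R := fun _ _ => 0.
pose f sg := jet_mul (jet_cst sg) (jet_mul U jet_rinv).
have wz0 x y : 0 < x -> j2 w x y = 0.
  move=> x0; apply: derivative_unique (jet_d2 (axi_w flow) y x0) _.
  have -> : jv w x = cst 0 by apply/funext => t; exact: vorticity_eq0.
  exact: is_derive_cst.
have of_ sg : jet_ok (f sg).
  apply: jet_mul_ok; first exact: jet_cst_ok.
  by apply: jet_mul_ok; [exact: axi_U flow|exact: jet_rinv_ok].
have Lf sg x y : 0 < x -> lap5 b0 b0 (f sg) x y = 0.
  move=> x0; have := axi_lapU flow y x0; rewrite wz0 // => E.
  have {}E : j11 U x y = - x^-1 * j1 U x y - j22 U x y + x^-1 ^+ 2 * jv U x y.
    by apply/eqP; rewrite -subr_eq0 -E; apply/eqP; ring.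
  by rewrite /lap5 /b0 /= E; field; rewrite gt_eqF.
have fle sg x y C : `|sg| = 1 -> 0 < x -> `|jv U x y| <= C -> jv (f sg) x y <= C * x^-1.
  move=> sg1 x0 h; apply: le_trans (ler_norm _) _.
  rewrite /= normrM sg1 mul1r normrM [`|x^-1|]gtr0_norm ?invr_gt0 //.
  by rewrite ler_pM2r // invr_gt0.
suff H (sg : R) : `|sg| = 1 -> forall d, 0 < d -> jv (f sg) r z <= d * r^-1.
  have rp (a : R) : (a * r^-1 <= 0) = (a <= 0) by rewrite pmulr_lle0 ?invr_gt0.
  have Hd (sg : R) : `|sg| = 1 -> sg * jv U r z <= 0.
    move=> sg1; apply/ler_addgt0Pr => e e0; rewrite add0r.
    by have := H sg sg1 e e0; rewrite /= mulrA ler_pM2r // invr_gt0.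
  have h1 := Hd 1 (normr1 _); have h2 : -1 * jv U r z <= 0.
    by apply: Hd; rewrite normrN normr1.
  lra.
move=> sg1 d d0; have [m m0 far] := u_decay d0.
pose rb := m + r + `|z| + 1.
have z0 := normr_ge0 z.
have mb : m < rb by rewrite /rb; lra.
have rb0 : 0 < rb by lra.
have farf x y : 0 < x -> m < x \/ m < `|y| -> jv (f sg) x y <= d * x^-1.
  by move=> x0 /(far x y x0) h; apply: fle => //; apply: norm_le_sqrD h; exact: ltW.
pose V := jet_mul (jet_cst d) jet_rinv.
apply: (@comparison_axis _ b0 b0 (f sg) V (axis_barrier 1) K rb (- rb) rb (of_ sg)).
- by apply: jet_mul_ok; [exact: jet_cst_ok|exact: jet_rinv_ok].
- exact: axis_barrier_ok.
- lra.
- by move=> x y /andP[x0 _] _; exact: Lf.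
- move=> x y /andP[x0 _] _.
  have -> : lap5 b0 b0 V x y = - (d * x^-1 ^+ 3).
    by rewrite /lap5 /b0 /=; field; rewrite gt_eqF.
  by rewrite oppr_le0 mulr_ge0 ?exprn_ge0 ?invr_ge0 // ltW.
- move=> x y /andP[x0 _] _; rewrite lap5_axis_barrier // /b0 !mulr0 mul0r addr0 sub0r.
  by rewrite mulrN1 oppr_lt0 exprn_gt0 // invr_gt0.
- by move=> x y /andP[x0 _] _; rewrite /= mulr_ge0 ?invr_ge0 // ltW.
- by move=> x y /andP[x0 _] _; rewrite /= mul1r expr2 lerDl invr_ge0; exact: ltW.
- by move=> x y /andP[x0 _] _; apply: fle => //; exact: (UK _ _ x0).1.
- by move=> y _; apply: farf => //; left.
- by move=> x /andP[x0 _]; apply: farf => //; right; rewrite normrN gtr0_norm.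
- by move=> x /andP[x0 _]; apply: farf => //; right; rewrite gtr0_norm.
- by rewrite r0 /= /rb; lra.
- have := ler_norm z; have := ler_norm (- z); rewrite normrN /rb; lra.
Qed.

Lemma axial_velocity_eq0 (r z : R) : 0 < r -> jv W r z = 0.
Proof.
move=> r0; have Wr0 x : 0 < x -> j1 W x z = 0.
  move=> x0; have := axi_curl flow z x0; rewrite vorticity_eq0 //.
  have -> : j2 U x z = 0.
    apply: derivative_unique (jet_d2 (axi_U flow) z x0) _.
    have -> : jv U x = cst 0 by apply/funext => t; exact: radial_velocity_eq0.
    exact: is_derive_cst.
  by rewrite sub0r => /eqP; rewrite eq_sym oppr_eq0 => /eqP.
apply/eqP; rewrite -normr_le0; apply/ler_addgt0Pr => e e0; rewrite add0r.
have [m m0 far] := u_decay e0.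
(* At radius [r + m] the decay estimate applies whatever the height, and [W] takes the same value
   there as at [r]. *)
have rx : r < r + m by rewrite ltrDl.
have [x /andP[rltx _]] := mean_value rx
  (fun x hx => jet_d1 (axi_W flow) z (lt_le_trans r0 (andP hx).1)).
rewrite Wr0 ?(lt_trans r0) // mul0r => /eqP; rewrite subr_eq0 => /eqP <-.
apply: (norm_le_sqrD (y := jv U (r + m) z)); first exact: ltW.
by rewrite addrC; apply: far; [exact: lt_trans rx|left; rewrite ltrDr].
Qed.

End Liouville.

(** * Reduction to the half plane *)

Local Notation i0 := (@Ordinal 3 0 isT).
Local Notation i1 := (@Ordinal 3 1 isT).
Local Notation i2 := (@Ordinal 3 2 isT).

Section PlaneRestriction.
Context {R : realType}.
Notation V3 := 'rV[R]_3.

Lemma ord3P (P : 'I_3 -> Prop) : P i0 -> P i1 -> P i2 -> forall i, P i.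
Proof.
move=> p0 p1 p2 [[|[|[|//]]] hi].
- by rewrite (_ : Ordinal hi = i0) //; exact: val_inj.
- by rewrite (_ : Ordinal hi = i1) //; exact: val_inj.
- by rewrite (_ : Ordinal hi = i2) //; exact: val_inj.
Qed.

Lemma sum_ord3 (V : nmodType) (F : 'I_3 -> V) : \sum_(i < 3) F i = F i0 + F i1 + F i2.
Proof.
by rewrite !big_ord_recr big_ord0 /= add0r; congr (F _ + F _ + F _); exact: val_inj.
Qed.

Lemma vec3E (a b c : R) :
  vec3 a b c = a *: basis_vec i0 + b *: basis_vec i1 + c *: basis_vec i2.
Proof.
apply/rowP; apply: ord3P; rewrite !mxE /= ?eqxx /=;
  by rewrite !(mulr1, mulr0, addr0, add0r).
Qed.

Lemma vec3_coord (x : V3) : x = vec3 (x 0 i0) (x 0 i1) (x 0 i2).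
Proof. by apply/rowP; apply: ord3P; rewrite mxE. Qed.

(* Locked: the unifier must not unfold partial derivatives into limits. *)
Definition pd : 'I_3 -> (V3 -> R) -> V3 -> R := locked (fun i f => partial i f).

Lemma pdE i (f : V3 -> R) : pd i f = partial i f.
Proof. by rewrite /pd -lock. Qed.

(** The chain rule is stated for general curves because it serves both for coordinate lines and for
    circles about the axis. *)
Lemma derivative_along (f : V3 -> R) (a b c : R -> R) (a' b' c' t : R) :
  differentiable f (vec3 (a t) (b t) (c t)) ->
  is_derive t 1 a a' -> is_derive t 1 b b' -> is_derive t 1 c c' ->
  is_derive t 1 (fun s => f (vec3 (a s) (b s) (c s)))
    (a' * pd i0 f (vec3 (a t) (b t) (c t))
     + b' * pd i1 f (vec3 (a t) (b t) (c t))
     + c' * pd i2 f (vec3 (a t) (b t) (c t))).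
Proof.
move=> df da db dc.
pose g s := vec3 (a s) (b s) (c s).
have gij i j : is_derive t 1 (fun s => g s i j) ((vec3 a' b' c') i j).
  rewrite ord1; move: j; apply: ord3P; rewrite mxE /=.
  - by rewrite (_ : (fun s => _) = a) //; apply/funext => s; rewrite mxE.
  - by rewrite (_ : (fun s => _) = b) //; apply/funext => s; rewrite mxE.
  - by rewrite (_ : (fun s => _) = c) //; apply/funext => s; rewrite mxE.
have dg : derivable g t 1 by apply/derivable_mxP => i j; have [] := gij i j.
have Dg : 'D_1 g t = vec3 a' b' c'.
  by rewrite derive_mx //; apply/matrixP => i j; rewrite mxE; have [_ ->] := gij i j.
have dg' : differentiable g t by exact/derivable1_diffP.
have dfg : differentiable (f \o g) t by exact: differentiable_comp.
apply: DeriveDef; first exact: diff_derivable.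
rewrite !pdE; change ('D_1 (f \o g) t = a' * partial i0 f (g t) + b' * partial i1 f (g t)
  + c' * partial i2 f (g t)).
rewrite deriveE // diff_comp //= -(deriveE _ dg') Dg vec3E !linearD !linearZ /=.
by rewrite /partial !deriveE.
Qed.

Lemma partial_coord (u : V3 -> V3) i j x : differentiable u x ->
  partial i (fun y => u y 0 j) x = partial i u x 0 j.
Proof. by move=> du; rewrite /partial derive_mx ?mxE //; exact: diff_derivable. Qed.

Lemma Ck_coord k (u : V3 -> V3) j : Ck k u -> Ck k (fun x => u x 0 j).
Proof.
elim: k u => [u cu x|k IH u [du dk]] /=.
  by apply: (@continuous_comp _ _ _ u (fun y : V3 => y 0 j)); [exact: cu|exact: coord_continuous].
split=> [x|i].
  exact: (differentiable_comp (du x) (differentiable_coord _ _ _)).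
rewrite (_ : partial i _ = fun x => partial i u x 0 j); first exact: (IH _ (dk i)).
by apply/funext => x; exact: partial_coord.
Qed.

Lemma smooth_coord (u : V3 -> V3) j : smooth u -> smooth (fun x => u x 0 j).
Proof. by move=> su k; exact: Ck_coord. Qed.

Lemma smooth_pd (f : V3 -> R) i : smooth f -> smooth (pd i f).
Proof. by move=> sf k; rewrite pdE; have [_] := sf k.+1; apply. Qed.

Lemma smooth_differentiable (f : V3 -> R) x : smooth f -> differentiable f x.
Proof. by move=> sf; have [] := sf 1%N. Qed.

Lemma pd_coord (u : V3 -> V3) i j x : smooth u ->
  pd i (fun y => u y 0 j) x = partial i u x 0 j.
Proof. by move=> su; rewrite pdE; apply: partial_coord; have [] := su 1%N. Qed.

Lemma pd2_coord (u : V3 -> V3) i j x : smooth u ->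
  pd i (pd i (fun y => u y 0 j)) x = partial i (partial i u) x 0 j.
Proof.
move=> su; have [_ d2u] := su 2%N.
have -> : pd i (fun y => u y 0 j) = fun y => partial i u y 0 j.
  by apply/funext => y; exact: pd_coord.
by rewrite pdE; apply: partial_coord; have [] := d2u i.
Qed.

(** This is the restriction to the half plane theta = 0. There [e_r] and [e_z] are the first and
    third basis vectors, so the cylindrical components and the derivatives in [r] and [z] are
    Cartesian ones. *)
Definition plane (f : V3 -> R) (r z : R) : R := f (vec3 r 0 z).

Lemma continuous_vec3 (y : R) : continuous (fun x : R * R => vec3 x.1 y x.2).
Proof.
move=> x; rewrite (_ : (fun x : R * R => _) =
    fun x => x.1 *: basis_vec i0 + y *: basis_vec i1 + x.2 *: basis_vec i2).
  apply: cvgD; first apply: cvgD; last 1 first.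
  - by apply: cvgZr_tmp; exact: cvg_snd.
  - by apply: cvgZr_tmp; exact: cvg_fst.
  - exact: cvg_cst.
by apply/funext => p; exact: vec3E.
Qed.

Lemma continuous_slice (f : V3 -> R) (y : R) : smooth f ->
  continuous (fun x : R * R => f (vec3 x.1 y x.2)).
Proof.
move=> sf x; apply: (@continuous_comp _ _ _ (fun x : R * R => vec3 x.1 y x.2) f).
  exact: continuous_vec3.
exact: (sf 0%N).
Qed.

Lemma derivative_slice_r (f : V3 -> R) (r y z : R) : smooth f ->
  is_derive r 1 (fun s => f (vec3 s y z)) (pd i0 f (vec3 r y z)).
Proof.
move=> sf; have := @derivative_along f id (cst y) (cst z) 1 0 0 r
  (smooth_differentiable _ sf) (is_derive_id _ _) (is_derive_cst _ _ _) (is_derive_cst _ _ _).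
by rewrite !mul0r !addr0 mul1r.
Qed.

Lemma derivative_slice_z (f : V3 -> R) (r y z : R) : smooth f ->
  is_derive z 1 (fun s => f (vec3 r y s)) (pd i2 f (vec3 r y z)).
Proof.
move=> sf; have := @derivative_along f (cst r) (cst y) id 0 0 1 z
  (smooth_differentiable _ sf) (is_derive_cst _ _ _) (is_derive_cst _ _ _) (is_derive_id _ _).
by rewrite !mul0r !add0r mul1r.
Qed.

Lemma pdC (f : V3 -> R) : smooth f ->
  pd i2 (pd i0 f) = pd i0 (pd i2 f).
Proof.
move=> sf; apply/funext => x; rewrite (vec3_coord x).
have s0 := smooth_pd i0 sf; have s2 := smooth_pd i2 sf.
apply: (@schwarz _ (fun r z => f (vec3 r (x 0 i1) z))
  (fun r z => pd i0 f (vec3 r (x 0 i1) z))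
  (fun r z => pd i2 f (vec3 r (x 0 i1) z))
  (fun r z => pd i2 (pd i0 f) (vec3 r (x 0 i1) z))
  (fun r z => pd i0 (pd i2 f) (vec3 r (x 0 i1) z))) => [r z|r z|r z|r z||].
- exact: derivative_slice_r.
- exact: derivative_slice_z.
- exact: derivative_slice_z.
- exact: derivative_slice_r.
- exact: (continuous_slice (smooth_pd i2 s0)).
- exact: (continuous_slice (smooth_pd i0 s2)).
Qed.

Definition plane_jet (f : V3 -> R) : @jet R := Jet (plane f)
  (plane (pd i0 f)) (plane (pd i2 f))
  (plane (pd i0 (pd i0 f))) (plane (pd i2 (pd i2 f))).

Lemma plane_jet_ok f : smooth f -> jet_ok (plane_jet f).
Proof.
move=> sf; split=> r z _ /=.
- exact: derivative_slice_r.
- exact: derivative_slice_z.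
- exact: (derivative_slice_r r 0 z (smooth_pd i0 sf)).
- exact: (derivative_slice_z r 0 z (smooth_pd i2 sf)).
- exact: (continuous_slice sf).
Qed.

(** The function is continuous across the axis, so the maximum can be taken over a closed rectangle
    that includes [r = 0]. *)
Lemma plane_bounded f (m : R) : smooth f -> exists C : R, forall r z : R,
  0 < r <= m -> - m <= z <= m -> `|plane f r z| <= C.
Proof.
move=> sf; have [m0|m0] := ltP 0 m; last first.
  by exists 0 => r z /andP[r0 rm]; have := lt_le_trans r0 (le_trans rm m0); rewrite ltxx.
have [|||c _ cmax] := @compact_EVT_max _ R (fun x : R * R => `|plane f x.1 x.2|)
    (`[0, m] `*` `[- m, m]).
- by exists (0, 0); split; rewrite /= in_itv /=; lra.
- by apply: compact_setX; exact: segment_compact.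
- apply: continuous_subspaceT => x.
  apply: (@continuous_comp _ _ _ (fun x : R * R => plane f x.1 x.2) Num.norm).
    exact: (continuous_slice sf).
  exact: norm_continuous.
exists `|plane f c.1 c.2| => r z hr hz; apply: (cmax (r, z)).
by rewrite inE; split; rewrite /= in_itv //=; lra.
Qed.

End PlaneRestriction.

(** * The axisymmetric equations without swirl *)

Section AxialSymmetry.
Context {R : realType}.
Notation V3 := 'rV[R]_3.

Lemma cyl_pointE (r t z : R) : cyl_point r t z = vec3 (r * cos t) (r * sin t) z.
Proof.
apply/rowP; apply: ord3P; rewrite !mxE /=;
  by rewrite !(mulr0, mulr1, addr0, add0r).
Qed.

Lemma cyl_point0 (r z : R) : cyl_point r 0 z = vec3 r 0 z.
Proof. by rewrite cyl_pointE cos0 sin0 mulr1 mulr0. Qed.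

Lemma dot3 (v : V3) (a b c : R) : dot v (vec3 a b c) = v 0 i0 * a + v 0 i1 * b + v 0 i2 * c.
Proof. by rewrite /dot sum_ord3 !mxE. Qed.

Lemma derivative_unique_gt0 (f g : R -> R) (x a b : R) :
  (forall y, 0 < y -> f y = g y) -> 0 < x ->
  is_derive x 1 f a -> is_derive x 1 g b -> a = b.
Proof.
move=> fg x0 df; apply: derivative_unique; apply: near_eq_is_derive df.
by near=> y; apply: fg; near: y; exact: lt_nbhsr.
Unshelve. all: by end_near. Qed.

(* Differentiate [f] twice along the circle through [(r, 0, z)] about the axis. *)
Lemma angular_derivatives (f : V3 -> R) (g g' : R -> R) (g'' r z : R) : smooth f ->
  (forall t, f (vec3 (r * cos t) (r * sin t) z) = g t) ->
  (forall t : R, is_derive t 1 g (g' t)) -> is_derive (0:R) 1 g' g'' ->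
  r * plane (pd i1 f) r z = g' 0 /\
  r ^+ 2 * plane (pd i1 (pd i1 f)) r z - r * plane (pd i0 f) r z = g''.
Proof.
move=> sf fg dg ddg.
have dcos (t : R) : is_derive t 1 (fun t => r * cos t) (- r * sin t).
  apply: (is_derive_eq (derivative_mul (is_derive_cst r t 1) (is_derive_cos t))).
  by rewrite /=; ring.
have dsin (t : R) : is_derive t 1 (fun t => r * sin t) (r * cos t).
  apply: (is_derive_eq (derivative_mul (is_derive_cst r t 1) (is_derive_sin t))).
  by rewrite /=; ring.
have dh (h : V3 -> R) (t : R) : smooth h ->
    is_derive t 1 (fun t => h (vec3 (r * cos t) (r * sin t) z))
    (- r * sin t * pd i0 h (vec3 (r * cos t) (r * sin t) z)
     + r * cos t * pd i1 h (vec3 (r * cos t) (r * sin t) z)).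
  move=> sh; have := derivative_along (c := cst z) (smooth_differentiable _ sh)
    (dcos t) (dsin t) (is_derive_cst z t 1).
  by rewrite mul0r addr0.
have v0 : vec3 (r * cos 0) (r * sin 0) z = vec3 r 0 z by rewrite cos0 sin0 mulr1 mulr0.
have dh0 (h : V3 -> R) : smooth h -> exists2 a : R -> R,
    (forall t, a t = h (vec3 (r * cos t) (r * sin t) z)) /\ a 0 = plane h r z &
    is_derive (0 : R) 1 a (r * plane (pd i1 h) r z).
  move=> sh; exists (fun t => h (vec3 (r * cos t) (r * sin t) z)).
    by split=> //; rewrite /plane -v0.
  have := dh h 0 sh; rewrite v0 cos0 sin0.
  by rewrite mulr0 mul0r add0r mulr1.
have [a [aE a0] da] := dh0 _ (smooth_pd i0 sf).
have [b [bE b0] db] := dh0 _ (smooth_pd i1 sf).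
have g'E : g' = fun t => - r * sin t * a t + r * cos t * b t.
  apply/funext => t; rewrite aE bE; apply: (derivative_unique (dg t)).
  have -> : g = fun t => f (vec3 (r * cos t) (r * sin t) z) by apply/funext => s; rewrite fg.
  exact: dh.
split; first by rewrite g'E sin0 cos0 b0 mulr1 mulr0 mul0r add0r.
have dmsin (t : R) : is_derive t 1 (fun t => - r * sin t) (- r * cos t).
  apply: (is_derive_eq (derivative_mul (is_derive_cst (- r) t 1) (is_derive_sin t))).
  by rewrite /=; ring.
rewrite g'E in ddg; have H := derivative_unique ddg
  (derivative_add (derivative_mul (dmsin 0) da) (derivative_mul (dcos 0) db)).
have algebra (A B C D : R) : g'' = - r * cos 0 * A + - r * sin 0 * (r * B)
    + (- r * sin 0 * C + r * cos 0 * (r * D)) -> r ^+ 2 * D - r * A = g''.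
  by move=> ->; rewrite cos0 sin0; ring.
by rewrite a0 b0 in H; exact: algebra H.
Qed.

Variables (u : V3 -> V3) (p : V3 -> R).
Hypotheses (u_smooth : smooth u) (p_smooth : smooth p).
Hypotheses (u_axi : axially_symmetric u) (u_no_swirl : no_swirl u).
Hypothesis NS : steady_navier_stokes u p.

Let u0 (x : V3) : R := u x 0 i0.
Let u1 (x : V3) : R := u x 0 i1.
Let u2 (x : V3) : R := u x 0 i2.
Let s0 : smooth u0 := smooth_coord i0 u_smooth.
Let s1 : smooth u1 := smooth_coord i1 u_smooth.
Let s2 : smooth u2 := smooth_coord i2 u_smooth.

(** The radial and vanishing azimuthal components at angle [t] form a rotation system for the two
    horizontal Cartesian components. Inverting it, with the radial component read off at angle 0,
    gives the formulas. *)
Lemma axial_components (r t z : R) : 0 < r ->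
  [/\ u0 (vec3 (r * cos t) (r * sin t) z) = plane u0 r z * cos t,
      u1 (vec3 (r * cos t) (r * sin t) z) = plane u0 r z * sin t &
      u2 (vec3 (r * cos t) (r * sin t) z) = plane u2 r z].
Proof.
move=> r0; have [ar _ az] := u_axi.
have algebra (a b c s A : R) : c ^+ 2 + s ^+ 2 = 1 -> a * c + b * s = A ->
    a * - s + b * c = 0 -> a = A * c /\ b = A * s.
  move=> cs E0 E1; split.
    have -> : a = a * (c ^+ 2 + s ^+ 2) by rewrite cs mulr1.
    transitivity ((a * c + b * s) * c - (a * - s + b * c) * s); first by ring.
    by rewrite E0 E1 mul0r subr0.
  have -> : b = b * (c ^+ 2 + s ^+ 2) by rewrite cs mulr1.
  transitivity ((a * c + b * s) * s + (a * - s + b * c) * c); first by ring.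
  by rewrite E0 E1 mul0r addr0.
have e0 := ar r t 0 z r0; have e1 := u_no_swirl t z r0; have e2 := az r t 0 z r0.
rewrite /comp_r /e_r !dot3 cyl_point0 cyl_pointE in e0.
rewrite /comp_theta /e_theta !dot3 cyl_pointE in e1.
rewrite /comp_z /e_z !dot3 cyl_point0 cyl_pointE in e2.
rewrite cos0 sin0 !(mulr0, mulr1, addr0) in e0; rewrite !(mulr0, addr0) in e1.
rewrite !(mulr0, mulr1, add0r) in e2.
by have [E0 E1] := algebra _ _ _ _ _ (cos2Dsin2 t) e0 e1; split.
Qed.

(** Derivatives transversal to the half plane are expressed through derivatives within it. This is
    the source of the terms in 1 / r and 1 / r^2 of the cylindrical divergence and Laplacian. *)
Lemma plane_angular (r z : R) : 0 < r ->
  [/\ plane u1 r z = 0, r * plane (pd i1 u1) r z = plane u0 r z,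
      r ^+ 2 * plane (pd i1 (pd i1 u0)) r z =
        r * plane (pd i0 u0) r z - plane u0 r z &
      r ^+ 2 * plane (pd i1 (pd i1 u2)) r z = r * plane (pd i0 u2) r z].
Proof.
move=> r0; set A := plane u0 r z.
have dcos (t : R) : is_derive t 1 (fun t => A * cos t) (- A * sin t).
  apply: (is_derive_eq (derivative_mul (is_derive_cst A t 1) (is_derive_cos t))).
  by rewrite /=; ring.
have dsin (t : R) : is_derive t 1 (fun t => A * sin t) (A * cos t).
  apply: (is_derive_eq (derivative_mul (is_derive_cst A t 1) (is_derive_sin t))).
  by rewrite /=; ring.
have dmsin (t : R) : is_derive t 1 (fun t => - A * sin t) (- A * cos t).
  apply: (is_derive_eq (derivative_mul (is_derive_cst (- A) t 1) (is_derive_sin t))).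
  by rewrite /=; ring.
have [_ h0] := angular_derivatives s0 (fun t => let: And3 h _ _ := axial_components t z r0 in h)
  dcos (dmsin 0).
have [h1 _] := angular_derivatives s1 (fun t => let: And3 _ h _ := axial_components t z r0 in h)
  dsin (dcos 0).
have [_ h2] := angular_derivatives s2 (fun t => let: And3 _ _ h := axial_components t z r0 in h)
  (fun t : R => is_derive_cst (plane u2 r z) t 1) (is_derive_cst (0 : R) (0 : R) 1).
have [_ h3 _] := axial_components 0 z r0.
move: h0 h1 h3; rewrite cos0 sin0 !(mulr0, mulr1) => h0 h1 h3; split=> //.
  have algebra (x y : R) : x - y = - A -> x = y - A by move=> <-; rewrite addrCA subrr addr0.
  exact: algebra h0.
by apply/eqP; rewrite -subr_eq0 h2.
Qed.

Lemma NS_coord j x :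
  u0 x * pd i0 (fun y => u y 0 j) x + u1 x * pd i1 (fun y => u y 0 j) x
  + u2 x * pd i2 (fun y => u y 0 j) x + pd j p x
  = pd i0 (pd i0 (fun y => u y 0 j)) x + pd i1 (pd i1 (fun y => u y 0 j)) x
  + pd i2 (pd i2 (fun y => u y 0 j)) x.
Proof.
have sumE (F : 'I_3 -> V3) : (\sum_(i < 3) F i) 0 j = F i0 0 j + F i1 0 j + F i2 0 j.
  by rewrite sum_ord3 !mxE.
have convE : convect u u x 0 j = u0 x * partial i0 u x 0 j + u1 x * partial i1 u x 0 j
    + u2 x * partial i2 u x 0 j.
  by rewrite /convect sumE; congr (_ + _ + _); rewrite mxE.
have gradE : grad p x 0 j = pd j p x by rewrite mxE pdE.
have lapE : laplacian u x 0 j = partial i0 (partial i0 u) x 0 j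
    + partial i1 (partial i1 u) x 0 j + partial i2 (partial i2 u) x 0 j.
  by rewrite /laplacian sumE.
have addE (v w : V3) : (v + w) 0 j = v 0 j + w 0 j by rewrite mxE.
transitivity (laplacian u x 0 j).
  rewrite -(NS.1 x) addE; congr (_ + _); last exact: esym gradE.
  by rewrite convE; congr (_ * _ + _ * _ + _ * _); exact: pd_coord.
by rewrite lapE; congr (_ + _ + _); apply/esym; exact: pd2_coord.
Qed.

Lemma div_coord x : pd i0 u0 x + pd i1 u1 x + pd i2 u2 x = 0.
Proof. by have := NS.2 x; rewrite /div sum_ord3 !pdE. Qed.

(** Differentiating the divergence equation turns the viscous terms into w_z and -(w_r + w / r). The
    momentum equations are then differentiated crosswise and subtracted, which eliminates the
    pressure. Symmetry of mixed derivatives is built into the hypotheses: [Urz], [Wrz] and [Prz]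
    each serve for both orders. *)
Lemma axiflow_intro (U W w : @jet R) (Pr Pz Prz Urz Wrz : R -> R -> R) :
  jet_ok U -> jet_ok W -> jet_ok w ->
  (forall r z : R, is_derive z 1 (j1 U r) (Urz r z)) ->
  (forall r z : R, is_derive r 1 (j2 U ^~ z) (Urz r z)) ->
  (forall r z : R, is_derive z 1 (j1 W r) (Wrz r z)) ->
  (forall r z : R, is_derive r 1 (j2 W ^~ z) (Wrz r z)) ->
  (forall r z : R, is_derive z 1 (Pr r) (Prz r z)) ->
  (forall r z : R, is_derive r 1 (Pz ^~ z) (Prz r z)) ->
  (forall r z, jv w r z = j2 U r z - j1 W r z) ->
  (forall r z, j1 w r z = Urz r z - j11 W r z) ->
  (forall r z, j2 w r z = j22 U r z - Wrz r z) ->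
  (forall r z : R, 0 < r -> j1 U r z + r^-1 * jv U r z + j2 W r z = 0) ->
  (forall r z : R, 0 < r -> jv U r z * j1 U r z + jv W r z * j2 U r z + Pr r z =
    j11 U r z + r^-1 * j1 U r z - r^-1 ^+ 2 * jv U r z + j22 U r z) ->
  (forall r z : R, 0 < r -> jv U r z * j1 W r z + jv W r z * j2 W r z + Pz r z =
    j11 W r z + r^-1 * j1 W r z + j22 W r z) ->
  axiflow U W w.
Proof.
move=> oU oW ow Uz Ur Wz Wr Pzd Prd wE w1 w2 dv E1 E3.
have dinv (r : R) : 0 < r -> is_derive r 1 (fun s => s^-1) (- r^-1 ^+ 2).
  move=> r0; have r_neq0 : id r != 0 by rewrite gt_eqF.
  apply: (is_derive_eq (derivative_inv r_neq0 (is_derive_id r 1))).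
  by rewrite mulN1r exprVn.
have dvr (r z : R) : 0 < r ->
    j11 U r z + (- r^-1 ^+ 2 * jv U r z + r^-1 * j1 U r z) + Wrz r z = 0.
  move=> r0; apply: (derivative_unique_gt0 (fun y => dv y z) r0) (is_derive_cst (0 : R) r 1).
  exact: (derivative_add (derivative_add (jet_d11 oU z r0)
    (derivative_mul (dinv r r0) (jet_d1 oU z r0))) (Wr r z)).
have dvz (r z : R) : 0 < r -> Urz r z + r^-1 * j2 U r z + j22 W r z = 0.
  move=> r0; have c := is_derive_cst (r^-1) z 1.
  have := derivative_add (derivative_add (Uz r z)
    (derivative_mul c (jet_d2 oU z r0))) (jet_d22 oW z r0).
  rewrite mul0r add0r => h; apply: derivative_unique h _.
  rewrite (_ : (fun y => _) = cst 0); first exact: is_derive_cst.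
  by apply/funext => y; exact: dv.
have lapU (r z : R) : 0 < r ->
    j11 U r z + r^-1 * j1 U r z + j22 U r z - r^-1 ^+ 2 * jv U r z = j2 w r z.
  by move=> r0; rewrite w2; have := dvr r z r0; lra.
have lapW (r z : R) : 0 < r ->
    j11 W r z + r^-1 * j1 W r z + j22 W r z = - (j1 w r z + r^-1 * jv w r z).
  by move=> r0; rewrite w1 wE; have := dvz r z r0; lra.
split=> // r z r0.
have F1 : j2 U r z * j1 U r z + jv U r z * Urz r z +
    (j2 W r z * j2 U r z + jv W r z * j22 U r z) + Prz r z = j22 w r z.
  apply: derivative_unique (jet_d22 ow z r0).
  rewrite (_ : j2 w r = fun y => jv U r y * j1 U r y + jv W r y * j2 U r y + Pr r y).
    exact: (derivative_add (derivative_add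
      (derivative_mul (jet_d2 oU z r0) (Uz r z))
      (derivative_mul (jet_d2 oW z r0) (jet_d22 oU z r0))) (Pzd r z)).
  by apply/funext => y; rewrite E1 // -lapU //; ring.
have F3 : j1 U r z * j1 W r z + jv U r z * j11 W r z +
    (j1 W r z * j2 W r z + jv W r z * Wrz r z) + Prz r z =
    - (j11 w r z + (- r^-1 ^+ 2 * jv w r z + r^-1 * j1 w r z)).
  apply: (@derivative_unique_gt0 (fun s => jv U s z * j1 W s z + jv W s z * j2 W s z + Pz s z)
    (fun s => - (j1 w s z + s^-1 * jv w s z)) r) => //.
  - by move=> s hs; rewrite E3 // lapW.
  - exact: (derivative_add (derivative_add
      (derivative_mul (jet_d1 oU z r0) (jet_d11 oW z r0))
      (derivative_mul (jet_d1 oW z r0) (Wr r z))) (Prd r z)).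
  - exact: (derivative_opp (derivative_add (jet_d11 ow z r0)
      (derivative_mul (dinv r r0) (jet_d1 ow z r0)))).
have D := dv r z r0.
(* The difference of the convective terms contains (U_r + W_z) w. Incompressibility replaces the
   factor by -U / r and so produces the stretching term. *)
have Ur1 : j1 U r z = - r^-1 * jv U r z - j2 W r z by lra.
transitivity (j22 w r z - (j1 U r z * j1 W r z + jv U r z * j11 W r z +
    (j1 W r z * j2 W r z + jv W r z * Wrz r z) + Prz r z)); first by rewrite F3; ring.
by rewrite -F1 w1 w2 wE Ur1; ring.
Qed.

Definition plane_vorticity : jet :=
  jet_add (plane_jet (pd i2 u0)) (jet_opp (plane_jet (pd i0 u2))).

Lemma plane_axiflow : axiflow (plane_jet u0) (plane_jet u2) plane_vorticity.
Proof.
have sp f i : smooth f -> smooth (pd i f : V3 -> R) by exact: smooth_pd.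
apply: (@axiflow_intro _ _ _ (plane (pd i0 p)) (plane (pd i2 p))
  (plane (pd i2 (pd i0 p))) (plane (pd i2 (pd i0 u0)))
  (plane (pd i2 (pd i0 u2)))).
- exact: plane_jet_ok.
- exact: plane_jet_ok.
- by apply: jet_add_ok; [|apply: jet_opp_ok]; apply: plane_jet_ok; exact: sp.
- by move=> r z; exact: (derivative_slice_z r 0 z (sp _ i0 s0)).
- by move=> r z; rewrite pdC //; exact: (derivative_slice_r r 0 z (sp _ i2 s0)).
- by move=> r z; exact: (derivative_slice_z r 0 z (sp _ i0 s2)).
- by move=> r z; rewrite pdC //; exact: (derivative_slice_r r 0 z (sp _ i2 s2)).
- by move=> r z; exact: (derivative_slice_z r 0 z (sp _ i0 p_smooth)).
- by move=> r z; rewrite pdC //; exact: (derivative_slice_r r 0 z (sp _ i2 p_smooth)).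
- by move=> r z; rewrite /= mulN1r.
- by move=> r z; rewrite /= mul0r add0r mulN1r pdC.
- by move=> r z; rewrite /= mul0r add0r mulN1r (pdC s2).
- move=> r z r0; have [_ h _ _] := plane_angular z r0; have := div_coord (vec3 r 0 z).
  have r1 : r != 0 by rewrite gt_eqF.
  have algebra (a b c d : R) : r * b = d -> a + b + c = 0 -> a + r^-1 * d + c = 0.
    by move=> <-; rewrite mulKf.
  exact: algebra.
- move=> r z r0; have [h1 _ h2 _] := plane_angular z r0.
  have := NS_coord i0 (vec3 r 0 z); rewrite -/(plane u1 r z) h1 mul0r addr0 => E.
  have r1 : r != 0 by rewrite gt_eqF.
  have algebra (l a b c d e : R) : r ^+ 2 * b = r * d - e -> l = a + b + c ->
      l = a + r^-1 * d - r^-1 ^+ 2 * e + c.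
    move=> hb ->; have -> : e = r * d - r ^+ 2 * b by rewrite hb; ring.
    by field.
  exact: algebra h2 E.
- move=> r z r0; have [h1 _ _ h2] := plane_angular z r0.
  have := NS_coord i2 (vec3 r 0 z); rewrite -/(plane u1 r z) h1 mul0r addr0 => E.
  have r1 : r != 0 by rewrite gt_eqF.
  have algebra (l a b c d : R) : r ^+ 2 * b = r * d -> l = a + b + c ->
      l = a + r^-1 * d + c.
    move=> hb ->; have -> : d = r^-1 * (r ^+ 2 * b) by rewrite hb mulKf.
    by field.
  exact: algebra h2 E.
Qed.

End AxialSymmetry.

(** * Return to three dimensions *)

Section Conclusion.
Context {R : realType}.
Notation V3 := 'rV[R]_3.

Lemma coord_le_enorm (x : V3) i : `|x 0 i| <= enorm x.
Proof.
rewrite -sqrtr_sqr /enorm; apply: ler_wsqrtr.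
rewrite /dot (bigD1 i) //= -expr2 lerDl; apply: sumr_ge0 => j _.
by rewrite -expr2 sqr_ge0.
Qed.

Lemma coord_le_norm (x : V3) i : `|x 0 i| <= `|x|.
Proof. by rewrite [leRHS]mx_normrE; exact: (le_bigmax _ (fun ij => `|x ij.1 ij.2|) (0, i)). Qed.

(** The angle is [acos (a / r)] with the sign of [b], which covers the full circle. *)
Lemma polar_coordinates (a b : R) : 0 < a ^+ 2 + b ^+ 2 ->
  exists r t : R, [/\ 0 < r, a = r * cos t & b = r * sin t].
Proof.
move=> ab0; pose r := Num.sqrt (a ^+ 2 + b ^+ 2).
have r0 : 0 < r by rewrite sqrtr_gt0.
have r2 : r ^+ 2 = a ^+ 2 + b ^+ 2 by rewrite sqr_sqrtr // ltW.
have ar : -1 <= a / r <= 1.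
  rewrite -ler_norml normf_div [`|r|]gtr0_norm // ler_pdivrMr // mul1r.
  by rewrite -sqrtr_sqr; apply: ler_wsqrtr; rewrite lerDl sqr_ge0.
have cosE : r * cos (acos (a / r)) = a by rewrite acosK ?in_itv // mulrC divfK // gt_eqF.
have sinE : r * sin (acos (a / r)) = `|b|.
  have b2 : b ^+ 2 = r ^+ 2 - a ^+ 2 by rewrite r2 addrC addKr.
  rewrite sin_acos // (_ : 1 - (a / r) ^+ 2 = (b / r) ^+ 2); last first.
    by rewrite !expr_div_n b2 mulrBl divff // expf_neq0 // gt_eqF.
  by rewrite sqrtr_sqr normf_div [`|r|]gtr0_norm // mulrC divfK // gt_eqF.
have [b0|b0] := leP 0 b.
  exists r, (acos (a / r)); split=> //.
  by rewrite sinE ger0_norm.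
exists r, (- acos (a / r)); split=> //; first by rewrite cosN.
by rewrite sinN mulrN sinE ltr0_norm // opprK.
Qed.

(** This carries the vanishing of [u] to the axis, where the cylindrical components give no
    information. *)
Lemma eq0_at_right (g : R -> R) : {for 0, continuous g} ->
  (forall r, 0 < r -> g r = 0) -> g 0 = 0.
Proof.
move=> cg g0; apply/eqP/negPn/negP => gn0.
have : \forall r \near (0 : R), g r != 0.
  have /cvgr_norm_gt := cg; move=> /(_ 0); rewrite normr_gt0 => /(_ gn0).
  by apply: filterS => r; rewrite normr_gt0.
move=> /nbhs_ballP[e /= e0 /(_ (e / 2))]; rewrite /ball /= sub0r normrN gtr0_norm ?divr_gt0 //.
by rewrite g0 ?divr_gt0 // eqxx => /(_ ltac:(lra)).
Qed.

Variables (u : V3 -> V3) (p : V3 -> R).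
Hypotheses (u_smooth : smooth u) (p_smooth : smooth p).
Hypotheses (u_axi : axially_symmetric u) (u_no_swirl : no_swirl u).
Hypothesis NS : steady_navier_stokes u p.
Hypothesis u_lim : u x @[x --> at_infinity] --> (0 : V3).

Let u0 (x : V3) : R := u x 0 i0.
Let u2 (x : V3) : R := u x 0 i2.

Lemma plane_decay (e : R) : 0 < e -> exists2 m : R, 0 < m & forall r z : R,
  0 < r -> m < r \/ m < `|z| -> plane u0 r z ^+ 2 + plane u2 r z ^+ 2 <= e ^+ 2.
Proof.
(* The limit is in the sup norm, so each component is at most [e / 2] and the two squares add up to
   at most half of [e ^+ 2]. *)
move=> e0; have e20 : 0 < e / 2 by rewrite divr_gt0.
have /cvgrPdist_lt /(_ (e / 2) e20) [M MP] := u_lim.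
exists (`|M| + 1) => [|r z r0 far]; first by rewrite ltr_wpDl.
have {}far : M < enorm (vec3 r 0 z).
  have h0 := coord_le_enorm (vec3 r 0 z) i0; have h2 := coord_le_enorm (vec3 r 0 z) i2.
  rewrite !mxE /= in h0 h2; have := ler_norm M; have := ler_norm r.
  by case: far; lra.
have := MP _ far; rewrite sub0r normrN => /ltW ue.
have sq i : (u (vec3 r 0 z) 0 i) ^+ 2 <= (e / 2) ^+ 2.
  rewrite -[leLHS]real_normK ?num_real // ler_sqr ?nnegrE //; last exact: ltW.
  exact: le_trans (coord_le_norm _ _) ue.
apply: le_trans (lerD (sq i0) (sq i2)) _.
by have := sqr_ge0 e; lra.
Qed.

Lemma plane_velocity_bounded : exists K : R, forall r z : R, 0 < r ->
  `|plane u0 r z| <= K /\ `|plane u2 r z| <= K.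
Proof.
have [m m0 far] := plane_decay ltr01.
have [C0 h0] := plane_bounded m (smooth_coord i0 u_smooth).
have [C2 h2] := plane_bounded m (smooth_coord i2 u_smooth).
exists (1 + `|C0| + `|C2|) => r z r0.
have c0 := normr_ge0 C0; have c2 := normr_ge0 C2.
have [[rm zm]|hf] : (r <= m /\ `|z| <= m) \/ (m < r \/ m < `|z|).
  have [rm|?] := leP r m; last by right; left.
  by have [zm|?] := leP `|z| m; [left|right; right].
  have hr : 0 < r <= m by rewrite r0.
  have hz : - m <= z <= m by rewrite -ler_norml.
  have := h0 r z hr hz; have := h2 r z hr hz; have := ler_norm C0; have := ler_norm C2.
  by rewrite -/u0 -/u2; move: (`|plane u0 r z|) (`|plane u2 r z|) => A B; split; lra.
have uz := far r z r0 hf.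
have A : `|plane u0 r z| <= 1 by exact: norm_le_sqrD uz.
have B : `|plane u2 r z| <= 1 by apply: (norm_le_sqrD (y := plane u0 r z)) => //; rewrite addrC.
by split; [apply: le_trans A _|apply: le_trans B _]; rewrite -addrA lerDl addr_ge0.
Qed.

Lemma plane_vorticity_bounded (m : R) : exists C : R, forall r z : R,
  0 < r <= m -> - m <= z <= m -> `|jv (plane_vorticity u) r z| <= C.
Proof.
have [C0 h0] := plane_bounded m (smooth_pd i2 (smooth_coord i0 u_smooth)).
have [C2 h2] := plane_bounded m (smooth_pd i0 (smooth_coord i2 u_smooth)).
exists (C0 + C2) => r z hr hz; rewrite /= mulN1r.
by apply: le_trans (ler_normB _ _) _; apply: lerD; [exact: h0|exact: h2].
Qed.

Lemma velocity_eq0 x : u x = 0.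
Proof.
have flow := plane_axiflow u_smooth p_smooth u_axi u_no_swirl NS.
have U0 (r z : R) : 0 < r -> plane u0 r z = 0.
  exact: (radial_velocity_eq0 flow plane_vorticity_bounded plane_decay plane_velocity_bounded).
have W0 (r z : R) : 0 < r -> plane u2 r z = 0.
  exact: (axial_velocity_eq0 flow plane_vorticity_bounded plane_decay plane_velocity_bounded).
have off_axis (r t z : R) : 0 < r -> u (vec3 (r * cos t) (r * sin t) z) = 0.
  move=> r0; have [e0 e1 e2] := axial_components u_axi u_no_swirl t z r0.
  rewrite U0 // mul0r in e0; rewrite U0 // mul0r in e1; rewrite W0 // in e2.
  by apply/rowP; apply: ord3P; rewrite [RHS]mxE.
have [ab|ab] := ltP 0 (x 0 i0 ^+ 2 + x 0 i1 ^+ 2).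
  have [r [t [r0 aE bE]]] := polar_coordinates ab.
  by rewrite (vec3_coord x) aE bE off_axis.
have x00 : x 0 i0 = 0.
  by apply/eqP; rewrite -sqrf_eq0 eq_le sqr_ge0 andbT; have := sqr_ge0 (x 0 i1); lra.
have x10 : x 0 i1 = 0.
  by apply/eqP; rewrite -sqrf_eq0 eq_le sqr_ge0 andbT; have := sqr_ge0 (x 0 i0); lra.
rewrite (vec3_coord x) x00 x10; apply/rowP => j; rewrite [RHS]mxE.
apply: (@eq0_at_right (fun r => u (vec3 r 0 (x 0 i2)) 0 j)).
  exact: derivative_continuous (derivative_slice_r 0 0 (x 0 i2) (smooth_coord j u_smooth)).
move=> r r0; have := off_axis r 0 (x 0 i2) r0.
by rewrite cos0 sin0 mulr1 mulr0 => ->; rewrite mxE.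
Qed.

End Conclusion.

Unset Implicit Arguments.

Theorem theorem2p1 (R : realType) (u : 'rV[R]_3 -> 'rV[R]_3) (p : 'rV[R]_3 -> R)
  (u_smooth : smooth u) (p_smooth : smooth p)
  (u_axi : axially_symmetric u) (u_no_swirl : no_swirl u)
  (up_NS : steady_navier_stokes u p)
  (u_lim : u x @[x --> at_infinity] --> (0 : 'rV[R]_3)) :
  forall x, u x = 0.
Proof. exact: velocity_eq0 u_smooth p_smooth u_axi u_no_swirl up_NS u_lim. Qed.
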